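(* Let $(\mathcal B,\mathcal A,i,e,l)$ be a cleft extension of length categories with finitely many isomorphism classes of simple objects and enough projective objects. Assume that $l$ is exact and that $e$ preserves projective objects. Set $L_e=\max\{\ell_{\mathcal B}(eS)\mid S\in\operatorname{simp}\mathcal A\}$, where $\ell_{\mathcal B}(eS)$ denotes the composition length of $eS$ in $\mathcal B$ and $\operatorname{simp}\mathcal A$ denotes the simple objects of $\mathcal A$. (a) Suppose that $e$ admits an exact right adjoint $r:\mathcal B\to\mathcal A$ and that $c_r:=\sup\{\operatorname{pd}_{\mathcal A}r(P)\mid P\in\operatorname{Proj}\mathcal B\}<\infty$. Then $$\operatorname{ddell}(\mathcal B)\le \operatorname{ddell}(\mathcal A)\le \operatorname{pd}(r)+L_e\bigl(\operatorname{ddell}(\mathcal B)+1\bigr).$$ Moreover, if $F^n=0$ for some $n\ge 1$ and $\operatorname{pd}(r)<\infty$, then, for every $k\ge 1$, $k\text{-}\operatorname{ddell}(\mathcal A)<\infty$ if and only if $k\text{-}\operatorname{ddell}(\mathcal B)<\infty$. (b) Suppose that $\operatorname{Im}G\subseteq\operatorname{Proj}\mathcal A$ (that is, $G(X)$ is projective for every $X\in\mathcal A$). Then, for every $k\ge1$, $$k\text{-}\operatorname{ddell}(\mathcal B)\le k\text{-}\operatorname{ddell}(\mathcal A)\le\max\bigl\{1,\ L_e\bigl(k\text{-}\operatorname{ddell}(\mathcal B)+1\bigr)-1\bigr\}.$$ In particular, $k\text{-}\operatorname{ddell}(\mathcal A)<\infty$ if and only if $k\text{-}\operatorname{ddell}(\mathcal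 B)<\infty$.
   Context: Abelian categories are essentially small and have enough projective objects. For such a category $\mathcal A$, $\operatorname{Proj}\mathcal A$ is the full subcategory of projective objects and $\underline{\mathcal A}=\mathcal A/[\operatorname{Proj}\mathcal A]$ is the stable category (factor out morphisms that factor through projectives). For each $X$ choose an epimorphism $P_X\to X$ with $P_X$ projective and put $\Omega X=\operatorname{Ker}(P_X\to X)$; this induces an additive endofunctor $\Omega$ of $\underline{\mathcal A}$, with iterates $\Omega^n$, $\Omega^0=\operatorname{id}$. $U$ is a stable retract of $V$ if $U$ is a retract of $V$ in $\underline{\mathcal A}$. For $k\ge1$ and $X\in\mathcal A$ (with $\inf\emptyset=\infty$): - $k\text{-}\operatorname{dell}_{\mathcal A}X=\inf\{n\ge0\mid \Omega^nX$ is a stable retract of $\Omega^{n+k}Y$ for some $Y\in\mathcal A\}$; - $k\text{-}\operatorname{ddell}_{\mathcal A}X=\inf\{m\ge0\mid$ there exist $0\le t\le m$ and an exact sequence $0\to C_t\to\cdots\to C_0\to X\to0$ with $(i+k)\text{-}\operatorname{dell}_{\mathcal A}C_i\le m-i$ for $0\le i\le t\}$. A length category is a skeletally small abelian category in which every object has a finite composition series. For a length category with finitely many isomorphism classes of simple objects, $k\text{-}\operatorname{ddell}(\mathcal A)=\sup\{k\text{-}\operatorname{ddell}_{\mathcal A}S\mid S \text{ simple in }\mathcal A\}$ and $\operatorname{ddell}(\mathcal A)=1\text{-}\operatorname{ddell}(\mathcal A)$. An expression on the right-hand side of an inequality is understood to be $\infty$ whenever one of the derived delooping levels occurring in it is infinite.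 A cleft extension $(\mathcal B,\mathcal A,i,e,l)$ of an abelian category $\mathcal B$ consists of functors $i:\mathcal B\to\mathcal A$, $e:\mathcal A\to\mathcal B$, $l:\mathcal B\to\mathcal A$ such that $e$ is faithful and exact, $l$ is left adjoint to $e$, and $ei\cong\operatorname{id}_{\mathcal B}$ naturally. The counit $le\to\operatorname{id}_{\mathcal A}$ is an epimorphism; $G:\mathcal A\to\mathcal A$ is its kernel, so $0\to G\to le\to\operatorname{id}_{\mathcal A}\to0$ is exact. The functor $F:\mathcal B\to\mathcal B$ is the kernel in the natural exact sequence $0\to F\to el\to\operatorname{id}_{\mathcal B}\to0$, where $el\cong e(le)i\to ei\cong\operatorname{id}_{\mathcal B}$ is $e$ applied to the counit at $i(-)$ (so $F\cong eGi$). For an exact functor $T:\mathcal C\to\mathcal D$, $\operatorname{pd}(T):=\sup\{\operatorname{pd}_{\mathcal D}T(P)\mid P\in\operatorname{Proj}\mathcal C\}\in\mathbb N\cup\{\infty\}$. *)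

(* Defs.v *)
From HB Require Import structures.
From mathcomp Require Import all_boot all_order all_algebra.
From mathcomp Require Import boolp.

Set Implicit Arguments.
Unset Strict Implicit.
Unset Printing Implicit Defensive.

Import GRing.Theory.
Local Open Scope ring_scope.

(** * Extended natural numbers *)

Inductive enat := Fin of nat | Inf.

Definition is_finite (x : enat) : Prop := exists n, x = Fin n.

Definition ele (x y : enat) : Prop :=
  match x, y with
  | _, Inf => True
  | Fin m, Fin n => (m <= n)%N
  | Inf, Fin _ => False
  end.

Definition eadd (x y : enat) : enat :=
  if (x, y) is (Fin m, Fin n) then Fin (m + n) else Inf.

(* [Inf] is absorbing, also against [Fin 0]. *)
Definition emul (x y : enat) : enat :=
  if (x, y) is (Fin m, Fin n) then Fin (m * n) else Inf.

(* [Inf - 1 = Inf] and [0 - 1 = 0]. *)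
Definition epred (x : enat) : enat :=
  if x is Fin m then Fin m.-1 else Inf.

Definition emax (x y : enat) : enat :=
  if (x, y) is (Fin m, Fin n) then Fin (maxn m n) else Inf.

Lemma asbool_ex (P : nat -> Prop) :
  (exists n, P n) -> exists n, (fun n => `[< P n >]) n.
Proof. by case=> n Pn; exists n; apply/asboolP. Qed.

(* The infimum of a set of natural numbers, [Inf] for the empty set. *)
Definition einf (P : nat -> Prop) : enat :=
  if pselect (exists n, P n) is left exP then Fin (ex_minn (asbool_ex exP))
  else Inf.

(* The supremum in [enat], i.e. the least upper bound; it is [Fin 0] for the
   empty set. *)
Definition esup (S : enat -> Prop) : enat :=
  einf (fun n => forall x, S x -> ele x (Fin n)).

(** * Preadditive categories *)

(* The type of objects is a type of some fixed universe, so these categories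
   are small; essentially small categories are treated by passing to an
   equivalent small one. *)
Record preadditive := Preadditive {
  obj :> Type;
  hom : obj -> obj -> zmodType;
  idm : forall X, hom X X;
  comp : forall X Y Z, hom Y Z -> hom X Y -> hom X Z;
  compA : forall X Y Z W (h : hom Z W) (g : hom Y Z) (f : hom X Y),
    comp h (comp g f) = comp (comp h g) f;
  comp1m : forall X Y (f : hom X Y), comp (idm Y) f = f;
  compm1 : forall X Y (f : hom X Y), comp f (idm X) = f;
  compDl : forall X Y Z (g h : hom Y Z) (f : hom X Y),
    comp (g + h) f = comp g f + comp h f;
  compDr : forall X Y Z (g : hom Y Z) (f h : hom X Y),
    comp g (f + h) = comp g f + comp g h
}.
Arguments hom {p} _ _.
Arguments idm {p} X.
Arguments comp {p X Y Z} _ _.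

Notation "g ∘ f" := (comp g f) (at level 40, left associativity).

Section Morphisms.
Variable C : preadditive.
Implicit Types X Y Z : C.

Definition mono X Y (f : hom X Y) : Prop :=
  forall Z (g h : hom Z X), f ∘ g = f ∘ h -> g = h.

Definition epi X Y (f : hom X Y) : Prop :=
  forall Z (g h : hom Y Z), g ∘ f = h ∘ f -> g = h.

Definition is_iso X Y (f : hom X Y) : Prop :=
  exists g : hom Y X, g ∘ f = idm X /\ f ∘ g = idm Y.

Definition isomorphic X Y : Prop := exists f : hom X Y, is_iso f.

Definition retract X Y : Prop :=
  exists (s : hom X Y) (p : hom Y X), p ∘ s = idm X.

Definition is_zero X : Prop :=
  forall Y, (forall f : hom X Y, f = 0) /\ (forall f : hom Y X, f = 0).

Definition is_kernel K X Y (k : hom K X) (f : hom X Y) : Prop :=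
  f ∘ k = 0 /\
  forall Z (g : hom Z X), f ∘ g = 0 -> exists! h : hom Z K, k ∘ h = g.

Definition is_cokernel X Y Q (q : hom Y Q) (f : hom X Y) : Prop :=
  q ∘ f = 0 /\
  forall Z (g : hom Y Z), g ∘ f = 0 -> exists! h : hom Q Z, h ∘ q = g.

Definition is_biproduct X Y W (i1 : hom X W) (i2 : hom Y W)
    (p1 : hom W X) (p2 : hom W Y) : Prop :=
  [/\ p1 ∘ i1 = idm X, p2 ∘ i2 = idm Y, p2 ∘ i1 = 0, p1 ∘ i2 = 0
    & i1 ∘ p1 + i2 ∘ p2 = idm W].

Definition short_exact X Y Z (f : hom X Y) (g : hom Y Z) : Prop :=
  is_kernel f g /\ is_cokernel g f.

(* Exactness at the middle object: the image of [f] is the kernel of [g]. *)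
Definition exact_at X Y Z (f : hom X Y) (g : hom Y Z) : Prop :=
  exists (I : C) (p : hom X I) (m : hom I Y),
    [/\ epi p, f = m ∘ p & is_kernel m g].

Definition projective P : Prop :=
  forall Y Z (g : hom Y Z) (f : hom P Z), epi g -> exists h, g ∘ h = f.

Definition simple S : Prop :=
  ~ is_zero S /\ forall Y (m : hom Y S), mono m -> is_zero Y \/ is_iso m.

(* [composition_series X n]: there is a chain of subobjects of [X], from zero
   to [X], whose [n] successive quotients are simple. *)
Inductive composition_series : C -> nat -> Prop :=
| CompositionNil X : is_zero X -> composition_series X 0
| CompositionCons Y X S n (f : hom Y X) (g : hom X S) :
    composition_series Y n -> short_exact f g -> simple S ->
    composition_series X n.+1.

Definition composition_length X : enat := einf (composition_series X).

(* An exact sequence 0 -> C_t -> ... -> C_0 -> X -> 0, with zero objects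
   written in all degrees above [t]. *)
Definition exact_resolution t (Cs : nat -> C) X : Prop :=
  exists (d : forall i, hom (Cs i.+1) (Cs i)) (a : hom (Cs 0%N) X),
    [/\ epi a, exact_at (d 0%N) a, forall i, exact_at (d i.+1) (d i)
      & forall i, (t < i)%N -> is_zero (Cs i)].

Definition pd X : enat :=
  einf (fun n => exists Ps : nat -> C,
    exact_resolution n Ps X /\ forall i, projective (Ps i)).

Lemma compBl X Y Z (g h : hom Y Z) (f : hom X Y) :
  (g - h) ∘ f = g ∘ f - h ∘ f.
Proof. by apply/eqP; rewrite eq_sym subr_eq -compDl subrK. Qed.

Lemma compBr X Y Z (g : hom Y Z) (f h : hom X Y) :
  g ∘ (f - h) = g ∘ f - g ∘ h.
Proof. by apply/eqP; rewrite eq_sym subr_eq -compDr subrK. Qed.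

Lemma comp0m X Y Z (f : hom X Y) : (0 : hom Y Z) ∘ f = 0.
Proof. by rewrite -(subrr (0 : hom Y Z)) compBl subrr. Qed.

Lemma compm0 X Y Z (g : hom Y Z) : g ∘ (0 : hom X Y) = 0.
Proof. by rewrite -(subrr (0 : hom X Y)) compBr subrr. Qed.

End Morphisms.

(** * Functors and natural transformations *)

Record functor (C D : preadditive) := Functor {
  fobj :> C -> D;
  fmap : forall X Y, hom X Y -> hom (fobj X) (fobj Y);
  fmap1 : forall X, fmap (idm X) = idm (fobj X);
  fmapM : forall X Y Z (g : hom Y Z) (f : hom X Y),
    fmap (g ∘ f) = fmap g ∘ fmap f
}.
Arguments fmap {C D} f {X Y} _ : rename.

Definition fun_id (C : preadditive) : functor C C.
Proof. by exists (fun X => X) (fun X Y f => f). Defined.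

Definition fun_comp (C D E : preadditive) (T : functor D E) (S : functor C D) :
  functor C E.
Proof.
exists (fun X => T (S X)) (fun X Y f => fmap T (fmap S f)).
- by move=> X; rewrite !fmap1.
- by move=> X Y Z g f; rewrite !fmapM.
Defined.

Record nat_trans (C D : preadditive) (S T : functor C D) := NatTrans {
  component :> forall X, hom (S X) (T X);
  naturality : forall X Y (f : hom X Y),
    component Y ∘ fmap S f = fmap T f ∘ component X
}.

Record nat_iso (C D : preadditive) (S T : functor C D) := NatIso {
  iso_to : nat_trans S T;
  iso_from : nat_trans T S;
  iso_fromK : forall X, iso_from X ∘ iso_to X = idm (S X);
  iso_toK : forall X, iso_to X ∘ iso_from X = idm (T X)
}.

(* [S] is left adjoint to [T]. *)
Record adjunction (C D : preadditive) (S : functor C D) (T : functor D C) :=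
  Adjunction {
    unit : nat_trans (fun_id C) (fun_comp T S);
    counit : nat_trans (fun_comp S T) (fun_id D);
    triangle_left : forall X, counit (S X) ∘ fmap S (unit X) = idm (S X);
    triangle_right : forall Y, fmap T (counit Y) ∘ unit (T Y) = idm (T Y)
  }.

(* A functor that is the kernel of the natural transformation [phi]. *)
Record kernel_functor (C D : preadditive) (S T : functor C D)
    (phi : nat_trans S T) := KernelFunctor {
  ker_fun :> functor C D;
  ker_incl : nat_trans ker_fun S;
  ker_inclP : forall X, is_kernel (ker_incl X) (phi X)
}.

Section FunctorProperties.
Variables (C D : preadditive) (T : functor C D).

Definition faithful : Prop :=
  forall X Y (f g : hom X Y), fmap T f = fmap T g -> f = g.

Definition exact_functor : Prop :=
  forall X Y Z (f : hom X Y) (g : hom Y Z),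
    short_exact f g -> short_exact (fmap T f) (fmap T g).

Definition preserves_projectives : Prop :=
  forall P : C, projective P -> projective (T P).

Definition pd_functor : enat :=
  esup (fun x => exists2 P : C, projective P & x = pd (T P)).

End FunctorProperties.

(** * Abelian categories *)

Record abelian := Abelian {
  abelian_cat :> preadditive;
  has_zero : exists Z : abelian_cat, is_zero Z;
  has_biproducts : forall X Y : abelian_cat,
    exists (W : abelian_cat) (i1 : hom X W) (i2 : hom Y W)
      (p1 : hom W X) (p2 : hom W Y), is_biproduct i1 i2 p1 p2;
  has_kernels : forall (X Y : abelian_cat) (f : hom X Y),
    exists (K : abelian_cat) (k : hom K X), is_kernel k f;
  has_cokernels : forall (X Y : abelian_cat) (f : hom X Y),
    exists (Q : abelian_cat) (q : hom Y Q), is_cokernel q f;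
  mono_normal : forall (X Y : abelian_cat) (f : hom X Y), mono f ->
    exists (Z : abelian_cat) (g : hom Y Z), is_kernel f g;
  epi_normal : forall (X Y : abelian_cat) (f : hom X Y), epi f ->
    exists (Z : abelian_cat) (g : hom Z X), is_cokernel f g
}.

Definition length_category (A : abelian) : Prop :=
  forall X : A, exists n, composition_series X n.

Definition finitely_many_simples (A : abelian) : Prop :=
  exists (n : nat) (s : 'I_n -> A),
    forall S : A, simple S -> exists i, isomorphic S (s i).

Definition enough_projectives (A : abelian) : Prop :=
  forall X : A, exists (P : A) (p : hom P X), projective P /\ epi p.

(** * The stable category *)

Section Stable.
Variable A : abelian.
Implicit Types X Y Z : A.

Definition factors_projective X Y (f : hom X Y) : bool :=
  `[< exists (P : A) (v : hom P Y) (u : hom X P), projective P /\ f = v ∘ u >].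

Lemma projective_zero (P : A) : is_zero P -> projective P.
Proof.
move=> P0 Y Z g f _; exists 0.
by rewrite compm0; symmetry; apply: (P0 Z).1.
Qed.

Lemma projective_biproduct (P Q W : A) (i1 : hom P W) (i2 : hom Q W)
    (p1 : hom W P) (p2 : hom W Q) :
  is_biproduct i1 i2 p1 p2 -> projective P -> projective Q -> projective W.
Proof.
case=> _ _ _ _ def1 prP prQ Y Z g f epi_g.
have [h1 def_h1] := prP _ _ g (f ∘ i1) epi_g.
have [h2 def_h2] := prQ _ _ g (f ∘ i2) epi_g.
exists (h1 ∘ p1 + h2 ∘ p2).
by rewrite compDr !compA def_h1 def_h2 -!compA -compDr def1 compm1.
Qed.

Lemma factors_projective_zmod_closed X Y :
  zmod_closed (@factors_projective X Y : {pred hom X Y}).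
Proof.
split; first apply/asboolP.
  have [Z Z0] := has_zero A; exists Z, 0, 0.
  by split; [exact: projective_zero | rewrite comp0m].
move=> f g /asboolP[P [v [u [prP ->]]]] /asboolP[Q [v' [u' [prQ ->]]]].
apply/asboolP.
have [W [i1 [i2 [p1 [p2 bW]]]]] := has_biproducts P Q.
exists W, (v ∘ p1 - v' ∘ p2), (i1 ∘ u + i2 ∘ u').
split; first exact: projective_biproduct bW prP prQ.
have [e11 e22 e21 e12 _] := bW.
rewrite compBl !compDr !compA -!(compA _ _ i1) -!(compA _ _ i2) e11 e22 e21 e12.
by rewrite !compm1 !compm0 !comp0m addr0 add0r.
Qed.

HB.instance Definition _ X Y :=
  GRing.isZmodClosed.Build (hom X Y) (@factors_projective X Y)
    (@factors_projective_zmod_closed X Y).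

Lemma factors_projective_compl X Y Z (g : hom Y Z) (f : hom X Y) :
  factors_projective f -> factors_projective (g ∘ f).
Proof.
case/asboolP=> P [v [u [prP ->]]]; apply/asboolP.
by exists P, (g ∘ v), u; rewrite compA.
Qed.

Lemma factors_projective_compr X Y Z (g : hom Y Z) (f : hom X Y) :
  factors_projective g -> factors_projective (g ∘ f).
Proof.
case/asboolP=> P [v [u [prP ->]]]; apply/asboolP.
by exists P, v, (u ∘ f); rewrite compA.
Qed.

Definition projective_ideal X Y : zmodClosed (hom X Y) :=
  GRing.ZmodClosed.clone (hom X Y) (@factors_projective X Y) _.

Definition stable_hom X Y : zmodType := Quotient.quot (projective_ideal X Y).

Definition stable_class X Y (f : hom X Y) : stable_hom X Y :=
  (\pi_(stable_hom X Y) f)%qT.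

Definition stable_repr X Y (f : stable_hom X Y) : hom X Y := generic_quotient.repr f.

Lemma stable_reprK X Y (f : stable_hom X Y) : stable_class (stable_repr f) = f.
Proof. exact: generic_quotient.reprK. Qed.

Lemma stable_classE X Y (f g : hom X Y) :
  stable_class f = stable_class g <-> factors_projective (f - g).
Proof.
have := Quotient.idealrBE (projective_ideal X Y) f g.
by rewrite /stable_class => E; split=> [/eqP|H]; rewrite -?E //; apply/eqP; rewrite -E.
Qed.

Lemma stable_classD X Y (f g : hom X Y) :
  stable_class (f + g) = stable_class f + stable_class g.
Proof. by rewrite /stable_class generic_quotient.piE. Qed.

Definition stable_comp X Y Z (g : stable_hom Y Z) (f : stable_hom X Y) :
  stable_hom X Z := stable_class (stable_repr g ∘ stable_repr f).

Lemma stable_compE X Y Z (g : hom Y Z) (f : hom X Y) :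
  stable_comp (stable_class g) (stable_class f) = stable_class (g ∘ f).
Proof.
apply/stable_classE; set g' := stable_repr _; set f' := stable_repr _.
have Hg : factors_projective (g' - g) by apply/stable_classE/stable_reprK.
have Hf : factors_projective (f' - f) by apply/stable_classE/stable_reprK.
have -> : g' ∘ f' - g ∘ f = (g' - g) ∘ f' + g ∘ (f' - f).
  by rewrite compBl compBr addrA subrK.
apply: (@rpredD _ (projective_ideal X Z)).
  exact: factors_projective_compr.
exact: factors_projective_compl.
Qed.

Lemma stable_ind X Y (Q : stable_hom X Y -> Prop) :
  (forall f, Q (stable_class f)) -> forall f, Q f.
Proof. by move=> H f; rewrite -(stable_reprK f). Qed.

(* The quotient A/[Proj A]: same objects, morphisms modulo those that factor
   through a projective object. *)
Definition stable_category : preadditive.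
Proof.
exists (obj A) stable_hom (fun X => stable_class (idm X)) stable_comp.
- move=> X Y Z W; elim/stable_ind=> h; elim/stable_ind=> g; elim/stable_ind=> f.
  by rewrite !stable_compE compA.
- by move=> X Y; elim/stable_ind=> f; rewrite stable_compE comp1m.
- by move=> X Y; elim/stable_ind=> f; rewrite stable_compE compm1.
- move=> X Y Z; elim/stable_ind=> g; elim/stable_ind=> h; elim/stable_ind=> f.
  by rewrite -stable_classD !stable_compE compDl stable_classD.
- move=> X Y Z; elim/stable_ind=> g; elim/stable_ind=> f; elim/stable_ind=> h.
  by rewrite -stable_classD !stable_compE compDr stable_classD.
Defined.

Definition stable_retract (U V : A) : Prop :=
  @retract stable_category U V.

End Stable.

(** * Delooping levels *)

(* For every object [X], a chosen epimorphism from a projective object [cover X]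
   onto [X], together with its kernel Omega X = [syzygy X]. *)
Record syzygy_choice (A : abelian) := SyzygyChoice {
  cover : A -> A;
  cover_projective : forall X, projective (cover X);
  cover_map : forall X, hom (cover X) X;
  cover_epi : forall X, epi (cover_map X);
  syzygy :> A -> A;
  syzygy_incl : forall X, hom (syzygy X) (cover X);
  syzygy_kernel : forall X, is_kernel (syzygy_incl X) (cover_map X)
}.

Section Delooping.
Variables (A : abelian) (Omega : syzygy_choice A).

Definition dell (k : nat) (X : A) : enat :=
  einf (fun n => exists Y : A,
    stable_retract (iter n Omega X) (iter (n + k) Omega Y)).

Definition ddell (k : nat) (X : A) : enat :=
  einf (fun m => exists t, (t <= m)%N /\
    exists Cs : nat -> A, exact_resolution t Cs X /\
      forall i, (i <= t)%N -> ele (dell (i + k) (Cs i)) (Fin (m - i))).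

Definition ddell_cat (k : nat) : enat :=
  esup (fun x => exists2 S : A, simple S & x = ddell k S).

End Delooping.

(** * Cleft extensions *)

Record cleft_extension (B A : abelian) := CleftExtension {
  cl_i : functor B A;
  cl_e : functor A B;
  cl_l : functor B A;
  cl_e_faithful : faithful cl_e;
  cl_e_exact : exact_functor cl_e;
  cl_adj : adjunction cl_l cl_e;
  cl_ei : nat_iso (fun_comp cl_e cl_i) (fun_id B)
}.

Section Cleft.
Variables (B A : abelian) (E : cleft_extension B A).

(* el ~ e(le)i -> ei ~ id, where the middle arrow is [e] applied to the counit
   at [i X]. *)
Definition el_to_id : nat_trans (fun_comp (cl_e E) (cl_l E)) (fun_id B).
Proof.
exists (fun X => iso_to (cl_ei E) X ∘ fmap (cl_e E) (counit (cl_adj E) (cl_i E X))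
   ∘ fmap (cl_e E) (fmap (cl_l E) (iso_from (cl_ei E) X))).
move=> X Y f /=.
rewrite -[LHS]compA -!fmapM /=.
have /= -> := naturality (iso_from (cl_ei E)) f.
rewrite !fmapM !compA -[X in X ∘ _ = _]compA -fmapM /=.
have /= -> := naturality (counit (cl_adj E)) (fmap (cl_i E) f).
by rewrite fmapM !compA; have /= -> := naturality (iso_to (cl_ei E)) f.
Defined.

(* The supremum over the simple objects is attained, as there are finitely many
   of them up to isomorphism. *)
Definition L_e : enat :=
  esup (fun x => exists2 S : A, simple S & x = composition_length (cl_e E S)).

End Cleft.

(* Main.v *)
Require Import Defs.
From mathcomp Require Import all_boot all_order all_algebra.
From mathcomp Require Import boolp zify.
(* Restores [hom], shadowed by [all_algebra]. *)
Import Defs.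

(* Write [0 -> K -> C -> X -> 0] for the first step of a resolution: then
   [k-ddell X <= m] unfolds recursively into [k-dell C <= m] and
   [(k+1)-ddell K <= m-1].  The horseshoe construction yields
   [k-ddell X <= k-ddell X' + k-ddell X'' + 1] for an extension [X] of [X''] by
   [X'], hence [k-ddell X <= n (d + 1) - 1] for [X] of length [n] when [d] bounds
   the levels of the simples.  An exact functor [T] for which [T P] has
   projective dimension at most [c] for all projective [P] raises [k-ddell] by
   at most [c]; this applies to [e] and [l] with [c = 0] and to [r] with
   [c = pd r].

   Lower bound: [i S] is simple for [S] simple, and [e (i S)] is isomorphic to
   [S].  (b): [S] is the quotient of [l (e S)] by the projective object [G S].
   (a): [S] embeds into [r (e S)] with cokernel [W]; rotating, [S] is up to
   projectives an extension of [r (e S)] by [Omega W], whose 1-dell is [0].  If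
   [F^n = 0], the cokernel construction [X |-> W] dies after [n] steps, since
   [Hom(Y, e W)] is isomorphic to [Hom(F Y, e X)]. *)

Set Implicit Arguments.
Unset Strict Implicit.
Unset Printing Implicit Defensive.

Import GRing.Theory.

(** * Monomorphisms, epimorphisms, kernels and pullbacks in preadditive categories *)

Section Preadditive.
Local Open Scope ring_scope.
Variable C : preadditive.
Implicit Types X Y Z W K : C.

Lemma mono0P X Y (f : hom X Y) :
  mono f <-> forall Z (g : hom Z X), f ∘ g = 0 -> g = 0.
Proof.
split=> [mf Z g fg0 | f0 Z g h fgh]; first by apply: mf; rewrite compm0.
by apply/eqP; rewrite -subr_eq0; apply/eqP/f0; rewrite compBr fgh subrr.
Qed.

Lemma epi0P X Y (f : hom X Y) :
  epi f <-> forall Z (g : hom Y Z), g ∘ f = 0 -> g = 0.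
Proof.
split=> [ef Z g gf0 | f0 Z g h gfh]; first by apply: ef; rewrite comp0m.
by apply/eqP; rewrite -subr_eq0; apply/eqP/f0; rewrite compBl gfh subrr.
Qed.

Lemma mono_comp X Y Z (g : hom Y Z) (f : hom X Y) : mono g -> mono f -> mono (g ∘ f).
Proof. by move=> mg mf W h k; rewrite -!compA => /mg/mf. Qed.

Lemma epi_comp X Y Z (g : hom Y Z) (f : hom X Y) : epi g -> epi f -> epi (g ∘ f).
Proof. by move=> eg ef W h k; rewrite !compA => /ef/eg. Qed.

Lemma mono_cancel X Y Z (g : hom Y Z) (f : hom X Y) : mono (g ∘ f) -> mono f.
Proof. by move=> m W h k fhk; apply: m; rewrite -!compA fhk. Qed.

Lemma epi_cancel X Y Z (g : hom Y Z) (f : hom X Y) : epi (g ∘ f) -> epi g.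
Proof. by move=> m W h k fhk; apply: m; rewrite !compA fhk. Qed.

Lemma is_iso_mono X Y (f : hom X Y) : is_iso f -> mono f.
Proof. by case=> g [gf _]; apply: (@mono_cancel _ _ _ g); rewrite gf => Z h k; rewrite !comp1m. Qed.

Lemma is_iso_epi X Y (f : hom X Y) : is_iso f -> epi f.
Proof. by case=> g [_ fg]; apply: (@epi_cancel _ _ _ _ g); rewrite fg => Z h k; rewrite !compm1. Qed.

Lemma isomorphic_sym X Y : isomorphic X Y -> isomorphic Y X.
Proof. by case=> f [g [gf fg]]; exists g, f. Qed.

Lemma is_zeroP X : is_zero X <-> idm X = 0.
Proof.
split=> [/(_ X)[X0 _] | X0 Y]; first exact: X0.
by split=> f; [rewrite -[f]compm1 | rewrite -[f]comp1m]; rewrite X0 ?compm0 ?comp0m.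
Qed.

Lemma is_zero_iso X Y : isomorphic X Y -> is_zero X -> is_zero Y.
Proof.
by case=> f [g [_ fg]] /is_zeroP X0; apply/is_zeroP; rewrite -fg -[f]compm1 X0 compm0 comp0m.
Qed.

Lemma kernelI K X Y (k : hom K X) (f : hom X Y) :
  mono k -> f ∘ k = 0 -> (forall Z (g : hom Z X), f ∘ g = 0 -> exists h, k ∘ h = g) ->
  is_kernel k f.
Proof.
move=> mk fk0 lift; split=> // Z g /lift[h kh]; exists h; split=> // h' kh'.
by apply: mk; rewrite kh.
Qed.

Lemma cokernelI X Y Q (q : hom Y Q) (f : hom X Y) :
  epi q -> q ∘ f = 0 -> (forall Z (g : hom Y Z), g ∘ f = 0 -> exists h, h ∘ q = g) ->
  is_cokernel q f.
Proof.
move=> eq fk0 lift; split=> // Z g /lift[h kh]; exists h; split=> // h' kh'.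
by apply: eq; rewrite kh.
Qed.

Lemma kernel_mono K X Y (k : hom K X) (f : hom X Y) : is_kernel k f -> mono k.
Proof.
case=> fk0 U Z g h kgh; have [|w [_ uw]] := U Z (k ∘ g); first by rewrite compA fk0 comp0m.
by rewrite -(uw g) // (uw h).
Qed.

Lemma cokernel_epi X Y Q (q : hom Y Q) (f : hom X Y) : is_cokernel q f -> epi q.
Proof.
case=> fk0 U Z g h kgh; have [|w [_ uw]] := U Z (g ∘ q); first by rewrite -compA fk0 compm0.
by rewrite -(uw g) // (uw h).
Qed.

Lemma kernel_lift K X Y (k : hom K X) (f : hom X Y) : is_kernel k f ->
  forall Z (g : hom Z X), f ∘ g = 0 -> exists h, k ∘ h = g.
Proof. by case=> _ U Z g /U[h [kh _]]; exists h. Qed.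

Lemma cokernel_lift X Y Q (q : hom Y Q) (f : hom X Y) : is_cokernel q f ->
  forall Z (g : hom Y Z), g ∘ f = 0 -> exists h, h ∘ q = g.
Proof. by case=> _ U Z g /U[h [kh _]]; exists h. Qed.

Section ShortExact.
Variables (X Y Z : C) (f : hom X Y) (g : hom Y Z).
Hypothesis fg : short_exact f g.

Lemma short_exact_mono : mono f. Proof. exact: kernel_mono fg.1. Qed.
Lemma short_exact_epi : epi g. Proof. exact: cokernel_epi fg.2. Qed.
Lemma short_exact_comp0 : g ∘ f = 0. Proof. exact: fg.1.1. Qed.

Lemma short_exact_lift W (h : hom W Y) : g ∘ h = 0 -> exists h', f ∘ h' = h.
Proof. exact: (kernel_lift fg.1). Qed.

Lemma short_exact_colift W (h : hom Y W) : h ∘ f = 0 -> exists h', h' ∘ g = h.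
Proof. exact: (cokernel_lift fg.2). Qed.

End ShortExact.

Definition is_pullback X Y Z W (g : hom X Z) (y : hom Y Z) (u : hom W X) (v : hom W Y) :=
  g ∘ u = y ∘ v /\
  forall V (a : hom V X) (b : hom V Y), g ∘ a = y ∘ b ->
    exists! w : hom V W, u ∘ w = a /\ v ∘ w = b.

Lemma pullback_sym X Y Z W (g : hom X Z) (y : hom Y Z) (u : hom W X) (v : hom W Y) :
  is_pullback g y u v -> is_pullback y g v u.
Proof.
case=> guv U; split=> // V a b /esym/U[w [[uw vw] uniq_w]].
by exists w; split=> // w' [? ?]; apply: uniq_w.
Qed.

Lemma pullback_kernel K X Y Z W (k : hom K X) (g : hom X Z) (y : hom Y Z)
    (u : hom W X) (v : hom W Y) :
  is_pullback g y u v -> is_kernel k g -> exists w : hom K W, u ∘ w = k /\ is_kernel w v.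
Proof.
move=> [guv U] kg; have [|w [[uw vw] _]] := U _ k 0; first by rewrite compm0 kg.1.
exists w; split=> //; apply: kernelI => //.
  by apply: (@mono_cancel _ _ _ u); rewrite uw; apply: kernel_mono kg.
move=> V t vt0.
have gut0 : g ∘ (u ∘ t) = 0 by rewrite compA guv -compA vt0 compm0.
have [s ks] := kernel_lift kg gut0; exists s.
have [|x [_ ux]] := U _ (u ∘ t) 0; first by rewrite gut0 compm0.
by rewrite -(ux t) // -(ux (w ∘ s)) // !compA uw ks vw comp0m.
Qed.

Lemma pullback_kernel_comp X Y Z W V (g : hom X Z) (y : hom Y Z)
    (u : hom W X) (v : hom W Y) (z : hom Z V) :
  is_pullback g y u v -> is_kernel y z -> is_kernel u (z ∘ g).
Proof.
move=> [guv U] yz; apply: kernelI.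
- apply/mono0P=> T t ut0.
  have vt0 : v ∘ t = 0.
    by apply: (kernel_mono yz); rewrite compm0 compA -guv -compA ut0 compm0.
  have [|x [_ ux]] := U _ (u ∘ t) 0; first by rewrite ut0 !compm0.
  by rewrite -(ux t) // -(ux 0) // !compm0.
- by rewrite -compA guv compA yz.1 comp0m.
- move=> T t; rewrite -compA => /(kernel_lift yz)[b yb].
  by have [|w [[uw _] _]] := U _ t b => //; exists w.
Qed.

End Preadditive.

(** * Short exact sequences, pullbacks and the horseshoe construction in abelian categories *)

Section Abelian.
Local Open Scope ring_scope.
Variable A : abelian.
Implicit Types X Y Z W K P : A.

(** The epimorphism [f] is the cokernel of some [g], and [g] factors through [k]. Hence a morphism
    killing [k] kills [g] and descends along [f]. *)
Lemma epi_cokernel_of_kernel K X Y (k : hom K X) (f : hom X Y) :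
  epi f -> is_kernel k f -> is_cokernel f k.
Proof.
move=> ef kf; apply: cokernelI; rewrite ?kf.1 // => T t tk0.
have [Z [g fg]] := epi_normal ef; apply: (cokernel_lift fg).
by have [h <-] := kernel_lift kf fg.1; rewrite compA tk0 comp0m.
Qed.

Lemma mono_kernel_of_cokernel X Y Q (f : hom X Y) (q : hom Y Q) :
  mono f -> is_cokernel q f -> is_kernel f q.
Proof.
move=> ef kf; apply: kernelI; rewrite ?kf.1 // => T t tk0.
have [Z [g fg]] := mono_normal ef; apply: (kernel_lift fg).
by have [h <-] := cokernel_lift kf fg.1; rewrite -compA tk0 compm0.
Qed.

Lemma kernel_short_exact K X Y (k : hom K X) (f : hom X Y) :
  is_kernel k f -> epi f -> short_exact k f.
Proof. by split=> //; apply: epi_cokernel_of_kernel. Qed.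

Lemma epi_short_exact X Y (f : hom X Y) :
  epi f -> exists K (k : hom K X), short_exact k f.
Proof.
by move=> ef; have [K [k kf]] := has_kernels f; exists K, k; apply: kernel_short_exact.
Qed.

Lemma mono_short_exact X Y (f : hom X Y) :
  mono f -> exists Q (q : hom Y Q), short_exact f q.
Proof.
move=> mf; have [Q [q fq]] := has_cokernels f; exists Q, q.
by split=> //; apply: mono_kernel_of_cokernel.
Qed.

Lemma iso_mono_epi X Y (f : hom X Y) : mono f -> epi f -> is_iso f.
Proof.
move=> mf ef; have [Q [q fq]] := mono_short_exact mf.
have q0 : q ∘ idm Y = 0 by rewrite compm1; apply: ((epi0P f).1 ef); rewrite fq.1.1.
have [g fg] := short_exact_lift fq q0; exists g; split=> //.
by apply: mf; rewrite compA fg comp1m compm1.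
Qed.

Lemma short_exact_iso_right X Y Z (f : hom X Y) (g : hom Y Z) :
  short_exact f g -> is_zero Z -> is_iso f.
Proof.
move=> fg Z0; apply: iso_mono_epi; first exact: short_exact_mono fg.
apply/epi0P=> W h /(short_exact_colift fg)[h' <-].
by rewrite ((Z0 W).1 h') comp0m.
Qed.

Lemma short_exact_iso_left X Y Z (f : hom X Y) (g : hom Y Z) :
  short_exact f g -> is_zero X -> is_iso g.
Proof.
move=> fg X0; apply: iso_mono_epi; last exact: short_exact_epi fg.
apply/mono0P=> W h /(short_exact_lift fg)[h' <-].
by rewrite ((X0 W).2 h') compm0.
Qed.

Lemma short_exact_postiso X Y Z Z' (f : hom X Y) (g : hom Y Z) (h : hom Z Z') :
  short_exact f g -> is_iso h -> short_exact f (h ∘ g).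
Proof.
move=> fg ih; apply: kernel_short_exact; last first.
  by apply: epi_comp; [apply: is_iso_epi | apply: short_exact_epi fg].
apply: kernelI; first exact: short_exact_mono fg.
  by rewrite -compA fg.1.1 compm0.
move=> W w hgw; apply: (short_exact_lift fg).
by apply: (is_iso_mono ih); rewrite compA hgw compm0.
Qed.

Lemma id_short_exact X Z : is_zero Z -> short_exact (0 : hom Z X) (idm X).
Proof.
move=> Z0; apply: kernel_short_exact; last by move=> T g h; rewrite !compm1.
apply: kernelI; rewrite ?compm0 //; first by move=> T g h _; rewrite ((Z0 T).2 g) ((Z0 T).2 h).
by move=> T g; rewrite comp1m => ->; exists 0; rewrite compm0.
Qed.

Lemma biproduct_short_exact X Y W (i1 : hom X W) (i2 : hom Y W) (p1 : hom W X) (p2 : hom W Y) :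
  is_biproduct i1 i2 p1 p2 -> short_exact i1 p2.
Proof.
case=> e11 e22 e21 e12 e; apply: kernel_short_exact; last first.
  by apply: (@epi_cancel _ _ _ _ _ i2); rewrite e22 => T g h; rewrite !compm1.
apply: kernelI => //.
  by apply: (@mono_cancel _ _ _ _ p1); rewrite e11 => T g h; rewrite !comp1m.
move=> T g pg0; exists (p1 ∘ g).
by rewrite -[RHS]comp1m -e compDl -!compA pg0 compm0 addr0.
Qed.

Lemma has_pullback X Y Z (g : hom X Z) (y : hom Y Z) :
  exists W (u : hom W X) (v : hom W Y), is_pullback g y u v.
Proof.
have [S [i1 [i2 [p1 [p2 [e11 e22 e21 e12 e]]]]]] := has_biproducts X Y.
have [W [k kk]] := has_kernels (g ∘ p1 - y ∘ p2).
exists W, (p1 ∘ k), (p2 ∘ k); split.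
  by apply/eqP; rewrite -subr_eq0 !compA -compBl kk.1.
move=> V a b gab.
have z : (g ∘ p1 - y ∘ p2) ∘ (i1 ∘ a + i2 ∘ b) = 0.
  rewrite compBl !compDr -!compA !(compA p1) !(compA p2) e11 e22 e21 e12.
  by rewrite !comp1m !comp0m !compm0 addr0 add0r gab subrr.
have [w kw] := kernel_lift kk z; exists w; split.
  rewrite -!compA kw !compDr !compA e11 e22 e21 e12.
  by rewrite !comp1m !comp0m addr0 add0r.
move=> w' [e1 e2]; apply: (kernel_mono kk).
by rewrite kw -e1 -e2 -!(compA _ k w') (compA i1) (compA i2) -compDl e comp1m.
Qed.

(** The map [psi] on the biproduct is epi, hence the cokernel of its kernel. If [t ∘ v = 0], then
    [t ∘ p2] kills that kernel and equals some [s ∘ psi]; restricting to [X] gives [s ∘ g = 0], so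
    [s] and then [t] vanish. *)
Lemma pullback_epi X Y Z W (g : hom X Z) (y : hom Y Z) (u : hom W X) (v : hom W Y) :
  is_pullback g y u v -> epi g -> epi v.
Proof.
move=> [guv U] eg; apply/epi0P=> T t tv0.
have [S [i1 [i2 [p1 [p2 [e11 e22 e21 e12 e]]]]]] := has_biproducts X Y.
pose psi := g ∘ p1 - y ∘ p2.
have psi1 : psi ∘ i1 = g by rewrite compBl -!compA e11 e21 compm0 compm1 subr0.
have epsi : epi psi by apply: (@epi_cancel _ _ _ _ _ i1); rewrite psi1.
have [K [k kpsi]] := epi_short_exact epsi.
have tk0 : t ∘ p2 ∘ k = 0.
  have [|w [[_ vw] _]] := U _ (p1 ∘ k) (p2 ∘ k).
    by apply/eqP; rewrite -subr_eq0 !compA -compBl kpsi.1.1.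
  by rewrite -compA -vw compA tv0 comp0m.
have [s st] := short_exact_colift kpsi tk0.
have s0 : s = 0.
  by apply: ((epi0P g).1 eg); rewrite -psi1 compA st -compA e21 compm0.
by rewrite -[t]compm1 -e22 compA -st s0 !comp0m.
Qed.

Lemma pullback_short_exact K X Y Z (k : hom K X) (g : hom X Z) (y : hom Y Z) :
  short_exact k g -> exists W (w : hom K W) (v : hom W Y) (u : hom W X),
    is_pullback g y u v /\ short_exact w v.
Proof.
move=> kg; have [W [u [v pb]]] := has_pullback g y.
have [w [_ wv]] := pullback_kernel pb kg.1; exists W, w, v, u; split=> //.
by apply: kernel_short_exact => //; apply: pullback_epi pb (short_exact_epi kg).
Qed.

(* For epimorphisms [C -> Y -> X] with kernels [K] and [Z], the kernel [K'] of
   the composite is the pullback of [C -> Y] along [Z -> Y]. *)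
Lemma comp_short_exact K C Y Z X (k : hom K C) (g : hom C Y) (y : hom Z Y) (z : hom Y X) :
  short_exact k g -> short_exact y z ->
  exists K' (k' : hom K K') (g' : hom K' Z) (u : hom K' C),
    short_exact k' g' /\ short_exact u (z ∘ g).
Proof.
move=> kg yz; have [W [w [v [u [pb wv]]]]] := pullback_short_exact y kg.
exists W, w, v, u; split=> //; apply: kernel_short_exact.
  exact: pullback_kernel_comp pb yz.1.
by apply: epi_comp; [apply: short_exact_epi yz | apply: short_exact_epi kg].
Qed.

(** The object [C'] is arbitrary, so that a term of a delooping resolution can stand there.
    Projectivity of [P''] supplies a lift of [a''] through [g], which together with [f ∘ a'] defines
    the map from the sum of [C'] and [P''] to [X]. *)
Lemma horseshoe X' X X'' K' C' K'' P'' (f : hom X' X) (g : hom X X'')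
    (k' : hom K' C') (a' : hom C' X') (k'' : hom K'' P'') (a'' : hom P'' X'') :
  projective P'' -> short_exact f g -> short_exact k' a' -> short_exact k'' a'' ->
  exists K C (k : hom K C) (a : hom C X) (s : hom K' K) (t : hom K K'')
     (i1 : hom C' C) (i2 : hom P'' C) (p1 : hom C C') (p2 : hom C P''),
  [/\ short_exact k a, short_exact s t & is_biproduct i1 i2 p1 p2].
Proof.
move=> prP fg ka' ka''.
have [h gh] := prP _ _ g a'' (short_exact_epi fg).
have [C [i1 [i2 [p1 [p2 bC]]]]] := has_biproducts C' P''.
have [e11 e22 e21 e12 e] := bC.
pose phi := f ∘ a' ∘ p1 + h ∘ p2.
have phi1 : phi ∘ i1 = f ∘ a' by rewrite compDl -!compA e11 e21 !compm0 compm1 addr0.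
have phi2 : phi ∘ i2 = h by rewrite compDl -!compA e22 e12 !compm0 compm1 add0r.
have gphi : g ∘ phi = a'' ∘ p2.
  by rewrite compDr !compA fg.1.1 !comp0m add0r gh.
have ephi : epi phi.
  apply/epi0P=> T t tphi.
  have tf : t ∘ f = 0.
    by apply: ((epi0P a').1 (short_exact_epi ka')); rewrite -compA -phi1 compA tphi comp0m.
  have [t' t'g] := short_exact_colift fg tf.
  have t'0 : t' = 0.
    apply: ((epi0P a'').1 (short_exact_epi ka'')).
    by rewrite -gh compA t'g -phi2 compA tphi comp0m.
  by rewrite -t'g t'0 comp0m.
have [K [k kphi]] := epi_short_exact ephi.
have z1 : phi ∘ (i1 ∘ k') = 0 by rewrite compA phi1 -compA ka'.1.1 compm0.
have [s ks] := short_exact_lift kphi z1.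
have z2 : a'' ∘ (p2 ∘ k) = 0 by rewrite compA -gphi -compA kphi.1.1 compm0.
have [t kt] := short_exact_lift ka'' z2.
exists K, C, k, phi, s, t, i1, i2, p1, p2; split=> //; apply: kernel_short_exact.
  apply: kernelI.
  - apply: (@mono_cancel _ _ _ _ k); rewrite ks; apply: mono_comp (short_exact_mono ka').
    by apply: (@mono_cancel _ _ _ _ p1); rewrite e11 => T u v; rewrite !comp1m.
  - apply: (short_exact_mono ka''); rewrite compA kt -compA ks compA e21.
    by rewrite comp0m compm0.
  - move=> T x tx.
    have p2x : p2 ∘ (k ∘ x) = 0 by rewrite compA -kt -compA tx compm0.
    have kx : k ∘ x = i1 ∘ (p1 ∘ (k ∘ x)).
      by rewrite -[LHS]comp1m -e compDl -!compA p2x compm0 addr0.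
    have a'0 : a' ∘ (p1 ∘ (k ∘ x)) = 0.
      apply: (short_exact_mono fg); rewrite compm0 compA -phi1 -compA -kx compA.
      by rewrite kphi.1.1 comp0m.
    have [y k'y] := short_exact_lift ka' a'0; exists y.
    by apply: (short_exact_mono kphi); rewrite compA ks -compA k'y -kx.
(* To see that [t] is epi, [h ∘ k''] is factored as [f ∘ y]. Over the pullback [E], the map [y]
   lifts along [a']; subtracting this lift from [i2 ∘ k'' ∘ e1] gives a map into [K] whose composite
   with [t] is the epimorphism [e1]. *)
have [|y fy] := @short_exact_lift _ _ _ _ _ _ fg _ (h ∘ k'').
  by rewrite compA gh ka''.1.1.
have [E [e0 [e1 [e2 [pb wv]]]]] := pullback_short_exact y ka'.
have z3 : phi ∘ (i2 ∘ (k'' ∘ e1) - i1 ∘ e2) = 0.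
  rewrite compBr !compA phi1 phi2 -!compA pb.1 !compA fy; exact: subrr.
have [x kx] := short_exact_lift kphi z3.
apply: (@epi_cancel _ _ _ _ _ x).
suff -> : t ∘ x = e1 by apply: short_exact_epi wv.
apply: (short_exact_mono ka''); rewrite compA kt -compA kx compBr !compA e22 e21.
by rewrite comp1m comp0m subr0.
Qed.

Lemma split_short_exact X Y P (f : hom X Y) (g : hom Y P) :
  projective P -> short_exact f g ->
  exists (s : hom P Y) (p : hom Y X), is_biproduct f s p g.
Proof.
move=> prP fg; have [s gs] := prP _ _ g (idm P) (short_exact_epi fg).
have [|p fp] := @short_exact_lift _ _ _ _ _ _ fg _ (idm Y - s ∘ g).
  by rewrite compBr compA gs comp1m compm1 subrr.
have mf := short_exact_mono fg; exists s, p; split=> //.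
- by apply: mf; rewrite compA fp compBl -compA fg.1.1 compm0 comp1m compm1 subr0.
- exact: fg.1.1.
- by apply: mf; rewrite compA fp compBl -compA gs compm0 comp1m compm1 subrr.
- by rewrite fp subrK.
Qed.

Lemma retract_projective X P : retract X P -> projective P -> projective X.
Proof.
case=> s [p ps] prP Y Z g f eg; have [h gh] := prP _ _ g (f ∘ p) eg.
by exists (h ∘ s); rewrite compA gh -compA ps compm1.
Qed.

End Abelian.

(** * Splitting off and prepending the first term of a resolution *)

Section Resolutions.
Local Open Scope ring_scope.
Variable A : abelian.
Implicit Types X Y Z K P U V Q : A.

Lemma exact_resolution0 (Cs : nat -> A) X :
  exact_resolution 0 Cs X -> isomorphic (Cs 0%N) X.
Proof.
case=> d [a [ea [I [p [m [ep _ ma]]]] _ C0]]; exists a; apply: iso_mono_epi => //.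
(* The image [I] of [d 0] is a quotient of the zero object [Cs 1]. *)
have I0 : is_zero I.
  apply/is_zeroP; apply: ep; rewrite comp1m comp0m; apply: (C0 1%N _ _).1; exact: isT.
by apply/mono0P=> Z g /(kernel_lift ma)[h <-]; rewrite ((I0 Z).2 h) compm0.
Qed.

Lemma exact_resolutionS t (Cs : nat -> A) X : exact_resolution t.+1 Cs X ->
  exists K (k : hom K (Cs 0%N)) (a : hom (Cs 0%N) X),
    short_exact k a /\ exact_resolution t (Cs \o succn) K.
Proof.
case=> d [a [ea [K [p [k [ep d0 ka]]]] ex C0]].
exists K, k, a; split; first exact: kernel_short_exact.
exists (fun i => d i.+1), p; split=> [//||i|i lt_ti]; [|exact: (ex i.+1)|exact: C0].
have [I [q [m [eq d1 md]]]] := ex 0%N; exists I, q, m; split=> //.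
have mk := kernel_mono ka; apply: kernelI; first exact: kernel_mono md.
  by apply: mk; rewrite compA -d0 md.1 compm0.
by move=> Z g pg; apply: (kernel_lift md); rewrite d0 -compA pg compm0.
Qed.

Lemma exact_resolution_refl X :
  exists Cs : nat -> A, exact_resolution 0 Cs X /\ Cs 0%N = X.
Proof.
have [Z Z0] := has_zero A; pose Cs i : A := if i is 0%N then X else Z.
exists Cs; split=> //; exists (fun i => 0 : hom (Cs i.+1) (Cs i)), (idm X); split.
- by move=> Y g h; rewrite !compm1.
- exists Z, (idm Z), 0; split; first by move=> Y g h; rewrite !compm1.
    by rewrite comp0m.
  exact: (id_short_exact X Z0).1.
- move=> i; exists Z, (idm Z), (idm Z).
  split; first by move=> Y g h; rewrite !compm1.
    by rewrite comp1m; symmetry; apply: (Z0 Z).1.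
  split; first exact: (Z0 _).1.
  move=> Y g _; exists 0; split; first by rewrite compm0; symmetry; apply: (Z0 Y).2.
  by move=> h _; symmetry; apply: (Z0 Y).2.
- by case.
Qed.

Lemma exact_resolution_cons t (Cs : nat -> A) K C X (k : hom K C) (a : hom C X) :
  short_exact k a -> exact_resolution t Cs K ->
  exact_resolution t.+1 (fun i => if i is j.+1 then Cs j else C) X.
Proof.
move=> ka [d [b [eb db ex C0]]].
pose D i : A := if i is j.+1 then Cs j else C.
pose dD i : hom (D i.+1) (D i) :=
  match i return hom (D i.+1) (D i) with 0%N => k ∘ b | j.+1 => d j end.
exists dD, a; split; first exact: short_exact_epi ka.
- by exists K, b, k; split=> //; apply: ka.1.
- case=> [|i]; last exact: ex.
  have [I [p [m [ep d0 mb]]]] := db; exists I, p, m; split=> //.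
  apply: kernelI; first exact: kernel_mono mb.
    by rewrite /= -compA mb.1 compm0.
  move=> Z g; rewrite /= -compA => kbg; apply: (kernel_lift mb).
  by apply: (short_exact_mono ka); rewrite kbg compm0.
- by case.
Qed.

End Resolutions.

(** * Stable retracts and their syzygies *)

Section StableRetracts.
Local Open Scope ring_scope.
Variable A : abelian.
Implicit Types X Y Z K P U V Q : A.

Lemma factors_projectiveD X Y (f g : hom X Y) :
  factors_projective f -> factors_projective g -> factors_projective (f + g).
Proof. exact: (@rpredD _ (projective_ideal X Y)). Qed.

Lemma factors_projectiveI X Y P (u : hom X P) (v : hom P Y) :
  projective P -> factors_projective (v ∘ u).
Proof. by move=> prP; apply/asboolP; exists P, v, u. Qed.

Lemma stable_retractP U V : stable_retract U V <->
  exists (s : hom U V) (p : hom V U), factors_projective (idm U - p ∘ s).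
Proof.
split=> [[s [p]] | [s [p ps]]].
  move: s p; elim/stable_ind=> s; elim/stable_ind=> p /= ps; exists s, p.
  by apply/stable_classE; rewrite -stable_compE; symmetry.
exists (stable_class s), (stable_class p); rewrite /= stable_compE.
by symmetry; apply/stable_classE.
Qed.

Lemma stable_retract_refl U : stable_retract U U.
Proof.
exists (idm (U : stable_category A)), (idm (U : stable_category A)); exact: comp1m.
Qed.

Lemma stable_retract_trans V U W :
  stable_retract U V -> stable_retract V W -> stable_retract U W.
Proof.
case=> s [p ps] [s' [p' ps']]; exists (s' ∘ s), (p ∘ p').
by rewrite -compA (compA p') ps' comp1m.
Qed.

Lemma retract_stable U V : retract U V -> stable_retract U V.
Proof.
case=> s [p ps]; apply/stable_retractP; exists s, p; rewrite ps subrr.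
exact: (@rpred0 _ (projective_ideal U U)).
Qed.

Lemma isomorphic_stable U V : isomorphic U V -> stable_retract U V.
Proof. by case=> f [g [gf _]]; apply: retract_stable; exists f, g. Qed.

Lemma projective_stable_retract U V : projective U -> stable_retract U V.
Proof.
move=> prU; apply/stable_retractP; exists 0, 0; rewrite comp0m subr0 -[idm U]comp1m.
exact: factors_projectiveI.
Qed.

Lemma stable_retract_projective U P :
  stable_retract U P -> projective P -> projective U.
Proof.
move=> /stable_retractP[s [p ps]] prP.
have /asboolP[Q [v [u [prQ e]]]] : factors_projective (idm U).
  by rewrite -[idm U](subrK (p ∘ s)); apply/factors_projectiveD/factors_projectiveI.
by apply: retract_projective prQ; exists u, v.
Qed.

Lemma biproduct_stable_retract X P Y (i1 : hom X Y) (i2 : hom P Y) (p1 : hom Y X) (p2 : hom Y P) :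
  is_biproduct i1 i2 p1 p2 -> projective P -> stable_retract X Y /\ stable_retract Y X.
Proof.
case=> e11 e22 e21 e12 e prP; split; first by apply: retract_stable; exists i1, p1.
apply/stable_retractP; exists p1, i1; rewrite -e [X in X - _]addrC addrK.
exact: factors_projectiveI.
Qed.

Lemma short_exact_stable_retract X Y P (f : hom X Y) (g : hom Y P) :
  projective P -> short_exact f g -> stable_retract X Y /\ stable_retract Y X.
Proof.
by move=> prP /(split_short_exact prP)[s [p b]]; apply: biproduct_stable_retract b prP.
Qed.

(* [U] is a direct summand of [V ⊕ Q ⊕ P] for a projective [P]. *)
Definition retract_modulo Q U V :=
  exists (s : hom U V) (p : hom V U) (u : hom U Q) (v : hom Q U)
    P (u' : hom U P) (v' : hom P U),
    projective P /\ idm U = p ∘ s + v ∘ u + v' ∘ u'.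

Lemma stable_retract_modulo Q U V : stable_retract U V -> retract_modulo Q U V.
Proof.
case/stable_retractP=> s [p /asboolP[P [v [u [prP e]]]]].
exists s, p, 0, 0, P, u, v; split=> //.
by rewrite compm0 addr0 -e addrC subrK.
Qed.

Lemma retract_modulo_stable Q U V :
  projective Q -> retract_modulo Q U V -> stable_retract U V.
Proof.
move=> prQ [s [p [u [v [P [u' [v' [prP e]]]]]]]].
apply/stable_retractP; exists s, p; rewrite e -[X in X - _]addrA [p ∘ s + _]addrC addrK.
by apply: factors_projectiveD; apply: factors_projectiveI.
Qed.

Lemma syzygy_map U' PU U V' PV V (kU : hom U' PU) (aU : hom PU U)
    (kV : hom V' PV) (aV : hom PV V) (s : hom U V) :
  projective PU -> short_exact kU aU -> short_exact kV aV ->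
  exists (s1 : hom PU PV) (s0 : hom U' V'), aV ∘ s1 = s ∘ aU /\ kV ∘ s0 = s1 ∘ kU.
Proof.
move=> prPU exU exV.
have [s1 e1] := prPU _ _ aV (s ∘ aU) (short_exact_epi exV).
have [|s0 e0] := @short_exact_lift _ _ _ _ _ _ exV _ (s1 ∘ kU).
  by rewrite compA e1 -compA exU.1.1 compm0.
by exists s1, s0.
Qed.

(** Lifting the maps to [PU], [PV] and [PQ] leaves a defect [d] of the identity of [PU] that is
    killed by [aU], so [d = kU ∘ h]. After restriction to [U'] the term through [P] vanishes, and
    [h ∘ kU] factors through the projective [PU] instead. *)
Lemma retract_modulo_syzygy Q' PQ Q U' PU U V' PV V (kQ : hom Q' PQ) (aQ : hom PQ Q)
    (kU : hom U' PU) (aU : hom PU U) (kV : hom V' PV) (aV : hom PV V) :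
  projective PQ -> projective PU -> projective PV ->
  short_exact kQ aQ -> short_exact kU aU -> short_exact kV aV ->
  retract_modulo Q U V -> retract_modulo Q' U' V'.
Proof.
move=> prQ prU prV exQ exU exV [s [p [u [v [P [u' [v' [prP e]]]]]]]].
have [s1 [s0 [s1E s0E]]] := syzygy_map s prU exU exV.
have [p1 [p0 [p1E p0E]]] := syzygy_map p prV exV exU.
have [u1 [u0 [u1E u0E]]] := syzygy_map u prU exU exQ.
have [v1 [v0 [v1E v0E]]] := syzygy_map v prQ exQ exU.
have [w wE] := prP _ _ aU v' (short_exact_epi exU).
pose d := idm PU - (p1 ∘ s1 + v1 ∘ u1 + w ∘ u' ∘ aU).
have [|h hE] := @short_exact_lift _ _ _ _ _ _ exU _ d.
  rewrite compBr !compDr !compA p1E v1E wE -(compA _ aV) -(compA _ aQ) s1E u1E.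
  by rewrite !compA -!compDl -e compm1 comp1m subrr.
exists s0, p0, u0, v0, PU, kU, h; split=> //.
apply: (short_exact_mono exU); rewrite !compDr !compA p0E v0E hE -!(compA _ kV) -!(compA _ kQ).
rewrite s0E u0E compBl !compDl comp1m compm1 -(compA _ aU) exU.1.1 compm0 addr0 !compA.
by rewrite addrC subrK.
Qed.

Lemma stable_retract_ses_syzygy U' PU U V' PV V (kU : hom U' PU) (aU : hom PU U)
    (kV : hom V' PV) (aV : hom PV V) :
  projective PU -> projective PV -> short_exact kU aU -> short_exact kV aV ->
  stable_retract U V -> stable_retract U' V'.
Proof.
move=> prU prV exU exV UV; have [Z Z0] := has_zero A; have prZ := projective_zero Z0.
apply: (@retract_modulo_stable Z) => //.
have exZ := id_short_exact Z Z0.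
exact: retract_modulo_syzygy prZ prU prV exZ exU exV (stable_retract_modulo _ UV).
Qed.

Variable Omega : syzygy_choice A.

Lemma syzygy_short_exact X : short_exact (syzygy_incl Omega X) (cover_map Omega X).
Proof. by apply: kernel_short_exact; [apply: syzygy_kernel | apply: cover_epi]. Qed.

Lemma stable_retract_iter n U V :
  stable_retract U V -> stable_retract (iter n Omega U) (iter n Omega V).
Proof.
move=> UV; elim: n => //= n; apply: stable_retract_ses_syzygy (syzygy_short_exact _) (syzygy_short_exact _);
exact: cover_projective.
Qed.

Lemma retract_modulo_iter n Q U V : retract_modulo Q U V ->
  retract_modulo (iter n Omega Q) (iter n Omega U) (iter n Omega V).
Proof.
move=> UV; elim: n => //= n; apply: retract_modulo_syzygy (syzygy_short_exact _)
  (syzygy_short_exact _) (syzygy_short_exact _); exact: cover_projective.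
Qed.

(** A stable form of Schanuel's lemma: the identity of [X] lifts to a comparison in both directions,
    so the chosen syzygy can be traded for the kernel of any projective presentation. *)
Lemma syzygy_unique K P X (k : hom K P) (a : hom P X) :
  projective P -> short_exact k a ->
  stable_retract K (Omega X) /\ stable_retract (Omega X) K.
Proof.
move=> prP ka; have prC := @cover_projective _ Omega X; have ex := syzygy_short_exact X.
split; first exact: stable_retract_ses_syzygy ka ex (stable_retract_refl X).
exact: stable_retract_ses_syzygy ex ka (stable_retract_refl X).
Qed.

Lemma iter_syzygy_projective n P : projective P -> projective (iter n Omega P).
Proof.
move=> prP; elim: n => //= n IHn; have [Z Z0] := has_zero A.
have [_ H] := syzygy_unique IHn (id_short_exact (iter n Omega P) Z0).
exact: stable_retract_projective H (projective_zero Z0).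
Qed.

(* Dimension shift along a short exact sequence whose middle term only becomes
   projective after [c] syzygies. *)
Lemma iter_syzygy_shift c K W X (k : hom K W) (a : hom W X) :
  short_exact k a -> projective (iter c Omega W) ->
  stable_retract (iter c Omega K) (iter c.+1 Omega X) /\
  stable_retract (iter c.+1 Omega X) (iter c Omega K).
Proof.
elim: c K W X k a => [|c IHc] K W X k a ka prW; first exact: syzygy_unique prW ka.
(* The horseshoe gives [0 -> Omega K -> L -> Omega X -> 0] with [L] a stable retract of [Omega W],
   so the induction hypothesis applies to it with one syzygy fewer left to take. *)
have [L [C [l [b [s [t [i1 [i2 [p1 [p2 [lb st bC]]]]]]]]]]] :=
  horseshoe (@cover_projective _ Omega X) ka (syzygy_short_exact K) (syzygy_short_exact X).
have prC : projective C by apply: projective_biproduct bC _ _; apply: cover_projective.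
have [LW _] := syzygy_unique prC lb.
rewrite (iterSr c.+1) (iterSr c Omega K); apply: IHc st _.
by apply: stable_retract_projective (stable_retract_iter c LW) _; rewrite -iterSr.
Qed.

Lemma pd_iter_syzygy n X : ele (pd X) (Fin n) -> projective (iter n Omega X).
Proof.
rewrite /pd /einf; case: pselect => // exP; case: ex_minnP => m /asboolP[Ps [exPs prPs]] _ /= le_mn.
suff prm : projective (iter m Omega X).
  by rewrite -(subnK le_mn) iterD; apply: iter_syzygy_projective.
elim: m {exP n le_mn} X Ps exPs prPs => [|m IHm] X Ps exPs prPs.
  apply: (stable_retract_projective (P := Ps 0%N)) => //.
  exact/isomorphic_stable/isomorphic_sym/exact_resolution0.
have [K [k [a [ka exK]]]] := exact_resolutionS exPs.
have [_ H] := syzygy_unique (prPs 0%N) ka.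
rewrite iterSr; apply: stable_retract_projective (stable_retract_iter m H) _.
by apply: IHm exK _ => i; apply: prPs.
Qed.

End StableRetracts.

(** * Finite bounds on infima and suprema *)

Section ExtendedNaturals.

Lemma ele_trans y x z : ele x y -> ele y z -> ele x z.
Proof. by case: x y z => [a|] [b|] [c|] //=; apply: leq_trans. Qed.

Lemma einf_le (P : nat -> Prop) n :
  ele (einf P) (Fin n) <-> exists m, (m <= n)%N /\ P m.
Proof.
rewrite /einf; case: pselect => [exP | nP]; last first.
  by split=> [[]|[m [_ Pm]]]; case: nP; exists m.
case: ex_minnP => m /asboolP Pm min_m; split=> [le_mn | [m' [le_m'n /asboolP/min_m le_mm']]].
  by exists m.
exact: leq_trans le_m'n.
Qed.

Lemma esup_le (S : enat -> Prop) n :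
  ele (esup S) (Fin n) <-> forall x, S x -> ele x (Fin n).
Proof.
rewrite einf_le; split=> [[m [le_mn ub]] x /ub xm | ub]; last by exists n.
exact: (@ele_trans (Fin m)).
Qed.

Lemma esup_leI (S : enat -> Prop) y :
  (forall n, y = Fin n -> forall x, S x -> ele x (Fin n)) -> ele (esup S) y.
Proof. by case: y => [n|] H; [apply/esup_le/H | case: esup]. Qed.

Lemma is_finite_le x : is_finite x <-> exists n, ele x (Fin n).
Proof. by split=> [[n ->]|[n]]; [exists n => /= | case: x => // m _; exists m]. Qed.

End ExtendedNaturals.

(** * Calculus of delooping levels and derived delooping levels *)

Section DeloopingLevels.
Local Open Scope ring_scope.
Variables (A : abelian) (Omega : syzygy_choice A).
Implicit Types X Y Z K P U V Q C : A.

Definition dell_le k m X :=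
  exists Y, stable_retract (iter m Omega X) (iter (m + k) Omega Y).

(** The first constructor is a resolution with [t = 0], the second prepends a term. Raising [k] and
    lowering [m] at each step reproduces the bounds [(i + k)]-dell [<= m - i], and allows induction
    on the resolution. *)
Inductive ddell_le : nat -> nat -> A -> Prop :=
| DdellLeDell k m X : dell_le k m X -> ddell_le k m X
| DdellLeStep k m K C X (f : hom K C) (g : hom C X) :
    short_exact f g -> dell_le k m.+1 C -> ddell_le k.+1 m K -> ddell_le k m.+1 X.

(** Further syzygies preserve stable retracts, so the set whose infimum defines [dell] is upward
    closed and a bound on [dell] is membership in it. *)
Lemma dell_leS k m n X : (m <= n)%N -> dell_le k m X -> dell_le k n X.
Proof.
move=> le_mn [Y XY]; exists Y; rewrite -(subnK le_mn) -addnA [X in stable_retract X]iterD.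
by rewrite [X in stable_retract _ X]iterD; apply: stable_retract_iter.
Qed.

Lemma dellP k m X : ele (dell Omega k X) (Fin m) <-> dell_le k m X.
Proof.
rewrite einf_le; split=> [[n [le_nm nX]] | mX]; last by exists m.
exact: dell_leS le_nm nX.
Qed.

Lemma dell_le_retract k m X X' : stable_retract X X' -> dell_le k m X' -> dell_le k m X.
Proof.
by move=> XX' [Y X'Y]; exists Y; apply: stable_retract_trans X'Y; apply: stable_retract_iter.
Qed.

Lemma dell_le_projective k m P : projective P -> dell_le k m P.
Proof.
by move=> prP; exists P; apply/projective_stable_retract/iter_syzygy_projective.
Qed.

Lemma dell_le_iter_syzygy k m X : dell_le k m (iter k Omega X).
Proof. by exists X; rewrite iterD; apply: stable_retract_refl. Qed.

Lemma dell_le_syzygy k m X : dell_le k m X -> dell_le k.+1 m (Omega X).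
Proof.
by case=> Y XY; exists Y; rewrite -iterSr addnS; apply: (stable_retract_iter Omega 1 XY).
Qed.

Lemma ddell_leS k m n X : (m <= n)%N -> ddell_le k m X -> ddell_le k n X.
Proof.
move=> le_mn mX; elim: mX n le_mn => {k m X} [k m X mX | k m K C X f g fg mC _ IH] [|n] //= le_mn.
- by apply: DdellLeDell; apply: dell_leS mX.
- by apply: DdellLeDell; apply: dell_leS mX.
- by apply: DdellLeStep fg _ (IH n le_mn); apply: dell_leS mC.
Qed.

Lemma ddell_le_iso k m X X' : isomorphic X X' -> ddell_le k m X -> ddell_le k m X'.
Proof.
move=> iXX' mX; case: mX X' iXX' => {k m X} [k m X mX | k m K C X f g fg mC mK] X' iXX'.
  by apply: DdellLeDell; apply: dell_le_retract mX; apply/isomorphic_stable/isomorphic_sym.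
have [h ih] := iXX'; exact: DdellLeStep (short_exact_postiso fg ih) mC mK.
Qed.

Lemma ddellP k m X : ele (ddell Omega k X) (Fin m) <-> ddell_le k m X.
Proof.
rewrite einf_le; split=> [[n [le_nm [t [le_tn [Cs [exC dC]]]]]] | mX].
  apply: (ddell_leS le_nm).
  elim: t n k X Cs le_tn exC dC {le_nm} => [|t IHt] n k X Cs le_tn exC dC.
    apply: ddell_le_iso (exact_resolution0 exC) _.
    by apply/DdellLeDell/dellP; have := dC 0%N isT; rewrite subn0.
  case: n le_tn dC => // n le_tn dC; have [K [f [g [fg exK]]]] := exact_resolutionS exC.
  apply: DdellLeStep fg _ _; first by apply/dellP; apply: dC.
  apply: IHt le_tn exK _ => i le_it; have /= := dC i.+1 le_it.
  by rewrite subSS addSnnS.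
exists m; split=> //; elim: {k m X} mX => [k m X mX | k m K C X f g fg mC _].
  have [Cs [exC C0]] := exact_resolution_refl X.
  exists 0%N; split=> //; exists Cs; split=> // [] [|i] // _.
  by rewrite subn0 C0; apply/dellP.
case=> t [le_tm [Cs [exC dC]]]; exists t.+1; split=> //.
exists (fun i => if i is j.+1 then Cs j else C); split; first exact: exact_resolution_cons fg exC.
case=> [_|i le_it]; first by rewrite subn0; apply/dellP.
by rewrite subSS addSnnS; apply: dC.
Qed.

(** The horseshoe over [0 -> K -> C -> X -> 0] yields [0 -> Omega K -> L -> Omega X -> 0] with [L] a
    stable retract of [Omega C]. Thus the whole resolution is replaced by its syzygies, each of
    which gains one in [k]. *)
Lemma ddell_le_syzygy k m X : ddell_le k m X -> ddell_le k.+1 m (Omega X).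
Proof.
elim=> {k m X} [k m X mX | k m K C X f g fg mC _ IH].
  by apply: DdellLeDell; apply: dell_le_syzygy.
have [L [D [l [b [s [t [i1 [i2 [p1 [p2 [lb st bD]]]]]]]]]]] :=
  horseshoe (@cover_projective _ Omega X) fg (syzygy_short_exact Omega K) (syzygy_short_exact Omega X).
have prD : projective D by apply: projective_biproduct bD _ _; apply: cover_projective.
have [LC _] := syzygy_unique Omega prD lb.
by apply: DdellLeStep st _ IH; apply: dell_le_retract LC _; apply: dell_le_syzygy.
Qed.

Lemma ddell_le_pred k m X : ddell_le k.+1 m X -> ddell_le k m X.
Proof.
have dell_le_pred j n Z : dell_le j.+1 n Z -> dell_le j n Z.
  by case=> Y ZY; exists (Omega Y); rewrite -iterSr -addnS.
move def_k: k.+1 => k' mX; elim: mX k def_k => {k' m X} [k' m X mX | k' m K C X f g fg mC _ IH] k def_k.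
  by apply/DdellLeDell/dell_le_pred; rewrite def_k.
apply: (DdellLeStep fg); first by apply: dell_le_pred; rewrite def_k.
by apply: IH; rewrite def_k.
Qed.

(* A resolution of [X'] is spliced with the syzygy of the resolution of [X'']
   lying above its top degree. *)
Lemma ddell_le_extension k a b X' X X'' (f : hom X' X) (g : hom X X'') :
  short_exact f g -> ddell_le k a X' -> ddell_le k b X'' -> ddell_le k (a + b).+1 X.
Proof.
move=> fg aX'; elim: aX' X X'' f g b fg => {k a X'}
  [k a X' aX' | k a K' C' X' k' a' ka' aC' _ IH] X X'' f g b fg bX''.
  have [Z Z0] := has_zero A.
  (* Here the first term is the sum of [X'] and the cover of [X''], and its kernel is isomorphic to
     [Omega X'']. Moving [X''] one place up the resolution costs the extra [1]. *)
  have [K [C [h [c [s [t [i1 [i2 [p1 [p2 [hc st bC]]]]]]]]]]] :=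
    horseshoe (@cover_projective _ Omega X'') fg (id_short_exact X' Z0) (syzygy_short_exact Omega X'').
  have [_ CX'] := biproduct_stable_retract bC (@cover_projective _ Omega X'').
  apply: (DdellLeStep hc); first by apply: dell_le_retract CX' _; apply: dell_leS aX'; lia.
  apply: (ddell_le_iso (X := Omega X'')).
    by apply: isomorphic_sym; exists t; apply: short_exact_iso_left st Z0.
  by apply: (@ddell_leS _ b); [lia | apply: ddell_le_syzygy].
have [K [C [h [c [s [t [i1 [i2 [p1 [p2 [hc st bC]]]]]]]]]]] :=
  horseshoe (@cover_projective _ Omega X'') fg ka' (syzygy_short_exact Omega X'').
have [_ CC'] := biproduct_stable_retract bC (@cover_projective _ Omega X'').
apply: (DdellLeStep hc).
  by apply: dell_le_retract CC' _; apply: dell_leS aC'; lia.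
exact: IH st (ddell_le_syzygy bX'').
Qed.

(** Only the first term of a resolution changes, and only by a projective summand, while [K] is kept
    up to isomorphism. From [X] to [S], the term [C] becomes the kernel of [C -> X -> P]; from [S]
    to [X], the summand [P] is added to [C]. *)
Lemma ddell_le_projective_quotient k m S X P (f : hom S X) (g : hom X P) :
  projective P -> short_exact f g -> ddell_le k m X <-> ddell_le k m S.
Proof.
move=> prP fg; have [SX XS] := short_exact_stable_retract prP fg.
split=> [mX | mS].
  case: mX S f g fg SX {XS} => {k m X} [k m X mX | k m K C X h c hc mC mK] S f g fg SX.
    exact/DdellLeDell/(dell_le_retract SX).
  have [C' [w [v [u [wv ugc]]]]] := comp_short_exact hc fg.
  have [C'C _] := short_exact_stable_retract prP ugc.
  exact: DdellLeStep wv (dell_le_retract C'C mC) mK.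
case: mS X f g fg XS {SX} => {k m S} [k m S mS | k m K C S h c hc mC mK] X f g fg XS.
  exact/DdellLeDell/(dell_le_retract XS).
have [Z Z0] := has_zero A.
have [L [D [l [b [s [t [i1 [i2 [p1 [p2 [lb st bD]]]]]]]]]]] :=
  horseshoe prP fg hc (id_short_exact P Z0).
have [_ DC] := biproduct_stable_retract bD prP.
apply: DdellLeStep lb (dell_le_retract DC mC) (ddell_le_iso _ mK).
by exists s; apply: short_exact_iso_right st Z0.
Qed.

(** The kernel [K'] of [C -> X -> S] is an extension of the projective [Q] by [K], so it has the
    level of [K]. If [X] is bounded by its own delooping level, the sequence from [Q] to [S] becomes
    a resolution step, which needs [m] positive. *)
Lemma ddell_le_projective_kernel k m Q X S (f : hom Q X) (g : hom X S) :
  (0 < m)%N -> projective Q -> short_exact f g -> ddell_le k m X -> ddell_le k m S.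
Proof.
case: m => // m _ prQ fg mX; move def_m: m.+1 mX => m' mX.
case: mX Q S f g prQ fg def_m => {k m' X} [k m' X mX | k m' K C X h c hc mC mK] Q S f g prQ fg def_m.
  rewrite -def_m in mX *; apply: DdellLeStep fg mX _.
  exact/DdellLeDell/dell_le_projective.
have [K' [w [v [u [wv ugc]]]]] := comp_short_exact hc fg.
apply: DdellLeStep ugc mC _.
exact/(ddell_le_projective_quotient _ _ prQ wv).
Qed.

(* The pullback of [D -> W] along [P_W -> W] is an extension of [D] by
   [Omega W], and of [P_W] by [S]. *)
Lemma ddell_le_sub k a b S D W (f : hom S D) (g : hom D W) :
  short_exact f g -> ddell_le k a (Omega W) -> ddell_le k b D -> ddell_le k (a + b).+1 S.
Proof.
move=> fg aW bD.
have [E [w [v [u [pb wv]]]]] := pullback_short_exact (cover_map Omega W) fg.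
apply/(ddell_le_projective_quotient _ _ (@cover_projective _ Omega W) wv).
have [x [_ xu]] := pullback_kernel (pullback_sym pb) (syzygy_short_exact Omega W).1.
have eu := pullback_epi (pullback_sym pb) (@cover_epi _ Omega W).
exact: ddell_le_extension (kernel_short_exact xu eu) aW bD.
Qed.

(** The first composition factor contributes [d] and each later one [d + 1]. Length zero is recorded
    as vanishing, so that an object of length one is identified with a simple object and pays for no
    extension. *)
Lemma ddell_le_composition_series k d X n : composition_series X n ->
  (forall S, simple S -> ddell_le k d S) ->
  if n is 0 then is_zero X else ddell_le k (n * d.+1).-1 X.
Proof.
move=> serX dS; elim: serX => {X n} [X X0 | Y X S n f g _ IH fg sS]; first exact: X0.
case: n IH => [Y0 | n nY].
  rewrite mul1n; apply: ddell_le_iso (dS S sS).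
  by apply: isomorphic_sym; exists g; apply: short_exact_iso_left fg Y0.
apply: ddell_leS (ddell_le_extension fg nY (dS S sS)); lia.
Qed.

Lemma ddell_le_length_category k d : length_category A ->
  (forall S, simple S -> ddell_le k d S) -> forall X, exists m, ddell_le k m X.
Proof.
move=> lenA dS X; have [n serX] := lenA X.
have := ddell_le_composition_series serX dS; case: n {serX} => [X0 | n mX]; last by eexists; apply: mX.
by exists 0%N; apply/DdellLeDell/dell_le_projective/projective_zero.
Qed.

Lemma ddell_cat_le k d :
  ele (ddell_cat Omega k) (Fin d) <-> forall S, simple S -> ddell_le k d S.
Proof.
rewrite esup_le; split=> [H S sS | H x [S sS ->]]; last exact/ddellP/H.
by apply/ddellP/H; exists S.
Qed.

Lemma ddell_cat_finite k : finitely_many_simples A ->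
  (forall X, exists m, ddell_le k m X) -> is_finite (ddell_cat Omega k).
Proof.
move=> [n [s sP]] fin; have [m mP] := fin_all_exists (fun i => fin (s i)).
apply/is_finite_le; exists (\max_i m i)%N; apply/ddell_cat_le => S /sP[i iS].
apply: ddell_le_iso (isomorphic_sym iS) _.
by apply: ddell_leS (mP i); apply: leq_bigmax.
Qed.

End DeloopingLevels.

(** * Exact functors and their effect on delooping levels *)

Section ExactFunctors.
Local Open Scope ring_scope.
Variables (A B : abelian) (T : functor A B).
Hypothesis exT : exact_functor T.

Lemma exact_functor_zero_obj X : is_zero X -> is_zero (T X).
Proof.
move=> X0; have ex := exT (id_short_exact X X0).
apply/is_zeroP; rewrite -(short_exact_comp0 ex) -fmapM comp1m -fmap1.
by rewrite ((is_zeroP X).1 X0).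
Qed.

Lemma exact_functor0 X Y : fmap T (0 : hom X Y) = 0.
Proof.
have [Z Z0] := has_zero A.
rewrite -[0](comp0m Y (0 : hom X Z)) fmapM.
by rewrite ((exact_functor_zero_obj Z0 (T X)).2 (fmap T 0)) compm0.
Qed.

(** Additivity follows from exactness. The defect [z] of the biproduct identity for [T W] is killed
    by [T p2], so it factors through [T i1], and composing with [T p1] shows that the factor is
    zero. Sums are then computed through [p1 + p2]. *)
Lemma exact_functorD X Y (f g : hom X Y) : fmap T (f + g) = fmap T f + fmap T g.
Proof.
have [W [i1 [i2 [p1 [p2 bW]]]]] := has_biproducts Y Y; have [e11 e22 e21 e12 e] := bW.
have exW := exT (biproduct_short_exact bW).
have TE : fmap T i1 ∘ fmap T p1 + fmap T i2 ∘ fmap T p2 = idm (T W).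
  apply/esym/eqP; rewrite -subr_eq0; set z := _ - _.
  have [|w wE] := @short_exact_lift _ _ _ _ _ _ exW _ z.
    rewrite compBr compDr !compA compm1 -(fmapM T p2 i1) -(fmapM T p2 i2) e21 e22.
    by rewrite exact_functor0 fmap1 comp0m comp1m add0r subrr.
  have : fmap T p1 ∘ z = 0.
    rewrite compBr compDr !compA compm1 -(fmapM T p1 i1) -(fmapM T p1 i2) e12 e11.
    by rewrite exact_functor0 fmap1 comp0m comp1m addr0 subrr.
  by rewrite -wE compA -fmapM e11 fmap1 comp1m => ->; rewrite compm0.
have -> : f + g = (p1 + p2) ∘ (i1 ∘ f + i2 ∘ g).
  rewrite compDl !compDr !compA e11 e22 e21 e12.
  by rewrite !comp1m !comp0m addr0 add0r.
have TpD : fmap T (p1 + p2) = fmap T p1 + fmap T p2.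
  rewrite -[LHS]compm1 -TE compDr !compA -!fmapM !compDl e11 e22 e21 e12.
  by rewrite !comp1m !comp0m addr0 add0r.
rewrite fmapM TpD compDl -!fmapM !compDr !compA e11 e22 e21 e12.
by rewrite !comp1m !comp0m addr0 add0r.
Qed.

Lemma exact_functor_mono X Y (f : hom X Y) : mono f -> mono (fmap T f).
Proof. by case/mono_short_exact=> Q [q /exT/short_exact_mono]. Qed.

Lemma exact_functor_epi X Y (f : hom X Y) : epi f -> epi (fmap T f).
Proof. by case/epi_short_exact=> K [k /exT/short_exact_epi]. Qed.

Section Faithful.
Hypothesis fT : faithful T.

Lemma faithful_mono X Y (f : hom X Y) : mono (fmap T f) -> mono f.
Proof. by move=> mf Z g h fgh; apply/fT/mf; rewrite -!fmapM fgh. Qed.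

Lemma faithful_epi X Y (f : hom X Y) : epi (fmap T f) -> epi f.
Proof. by move=> mf Z g h fgh; apply/fT/mf; rewrite -!fmapM fgh. Qed.

Lemma faithful_zero X : is_zero (T X) -> is_zero X.
Proof. by move=> /is_zeroP TX0; apply/is_zeroP/fT; rewrite fmap1 exact_functor0. Qed.

Lemma faithful_iso X Y (f : hom X Y) : is_iso (fmap T f) -> is_iso f.
Proof.
move=> iTf; apply: iso_mono_epi; first exact/faithful_mono/is_iso_mono.
exact/faithful_epi/is_iso_epi.
Qed.

Lemma faithful_simple X : simple (T X) -> simple X.
Proof.
case=> nz subT; split=> [X0 | Y m mm]; first by apply: nz; apply: exact_functor_zero_obj.
by have [/faithful_zero|/faithful_iso] := subT _ _ (exact_functor_mono mm); [left | right].
Qed.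

End Faithful.

Lemma fmap_iso X Y : isomorphic X Y -> isomorphic (T X) (T Y).
Proof.
by case=> f [g [gf fg]]; exists (fmap T f), (fmap T g); rewrite -!fmapM gf fg !fmap1.
Qed.

Variables (OmegaA : syzygy_choice A) (OmegaB : syzygy_choice B) (c : nat).
Hypothesis Tproj : forall P, projective P -> projective (iter c OmegaB (T P)).

(** A morphism through a projective [P] is sent to one through [T P], which need not be projective.
    It is carried along as the summand [Q] of [retract_modulo] until [c] syzygies make it
    projective. *)
Lemma stable_retract_functor U V : stable_retract U V ->
  stable_retract (iter c OmegaB (T U)) (iter c OmegaB (T V)).
Proof.
case/stable_retractP=> s [p /asboolP[P [v [u [prP e]]]]].
have [Z Z0] := has_zero B.
apply: (retract_modulo_stable (Tproj prP)); apply: retract_modulo_iter.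
exists (fmap T s), (fmap T p), (fmap T u), (fmap T v), Z, 0, 0.
split; first exact: projective_zero.
by rewrite compm0 addr0 -!fmapM -exact_functorD -fmap1 -e addrC subrK.
Qed.

(** The image under [T] of a syzygy sequence has a middle term that is projective after [c]
    syzygies, so the dimension shift moves syzygies through [T] one at a time. *)
Lemma iter_syzygy_functor n X :
  stable_retract (iter c OmegaB (T (iter n OmegaA X))) (iter (c + n) OmegaB (T X)) /\
  stable_retract (iter (c + n) OmegaB (T X)) (iter c OmegaB (T (iter n OmegaA X))).
Proof.
elim: n => [|n [IH1 IH2]]; first by rewrite addn0; split; apply: stable_retract_refl.
have [H1 H2] := iter_syzygy_shift (exT (syzygy_short_exact OmegaA (iter n OmegaA X)))
  (Tproj (@cover_projective _ OmegaA _)).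
rewrite addnS /=; split.
  exact: stable_retract_trans H1 (stable_retract_iter OmegaB 1 IH1).
exact: stable_retract_trans (stable_retract_iter OmegaB 1 IH2) H2.
Qed.

Lemma dell_le_functor k m X : dell_le OmegaA k m X -> dell_le OmegaB k (c + m) (T X).
Proof.
case=> Y XY; exists (T Y); rewrite -addnA.
apply: stable_retract_trans (iter_syzygy_functor m X).2 _.
apply: stable_retract_trans (iter_syzygy_functor (m + k) Y).1.
exact: stable_retract_functor.
Qed.

Lemma ddell_le_functor k m X : ddell_le OmegaA k m X -> ddell_le OmegaB k (c + m) (T X).
Proof.
elim=> {k m X} [k m X mX | k m K C X f g fg mC _ IH].
  exact/DdellLeDell/dell_le_functor.
rewrite addnS; apply: DdellLeStep (exT fg) _ IH.
by rewrite -addnS; apply: dell_le_functor.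
Qed.

End ExactFunctors.

(** * Adjunctions: projective objects, units and counits *)

Section Adjunctions.
Local Open Scope ring_scope.
Variables (C D : abelian) (S : functor C D) (T : functor D C) (adj : adjunction S T).

Lemma left_adjoint_projective : exact_functor T -> preserves_projectives S.
Proof.
move=> exT P prP Y Z g f eg.
have [h gh] := prP _ _ (fmap T g) (fmap T f ∘ unit adj P) (exact_functor_epi exT eg).
exists (counit adj Y ∘ fmap S h); rewrite compA -(naturality (counit adj)) /=.
rewrite -compA -fmapM gh fmapM compA.
have /= -> := naturality (counit adj) f.
by rewrite -compA triangle_left compm1.
Qed.

Lemma counit_epi : faithful T -> forall Y, epi (counit adj Y).
Proof.
move=> fT Y; apply: (faithful_epi fT); apply: (@epi_cancel _ _ _ _ _ (unit adj (T Y))).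
by rewrite triangle_right => Z g h; rewrite !compm1.
Qed.

Lemma unit_mono : faithful S -> forall X, mono (unit adj X).
Proof.
move=> fS X; apply: (faithful_mono fS); apply: (@mono_cancel _ _ _ _ (counit adj (S X))).
by rewrite triangle_left => Z g h; rewrite !comp1m.
Qed.

End Adjunctions.

(** * Simple objects and the counit in a cleft extension *)

Section Cleft.
Local Open Scope ring_scope.
Variables (B A : abelian) (E : cleft_extension B A).
Let e := cl_e E.
Let l := cl_l E.
Let u (Y : B) : hom Y (e (l Y)) := unit (cl_adj E) Y.

Lemma composition_series_iso (X Y : B) n :
  isomorphic X Y -> composition_series X n -> composition_series Y n.
Proof.
move=> iXY cX; case: cX Y iXY => {X n} [X X0 | W X S n f g cW fg sS] Y.
  by move=> /is_zero_iso/(_ X0)/CompositionNil.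
case=> h [h' [h'h hh']]; apply: (CompositionCons (f := h ∘ f) (g := g ∘ h') cW _ sS).
have ih' : is_iso h' by exists h.
apply: kernel_short_exact; last first.
  exact: epi_comp (short_exact_epi fg) (is_iso_epi ih').
apply: kernelI.
- by apply: mono_comp (short_exact_mono fg); apply: is_iso_mono; exists h'.
- by rewrite -compA (compA h') h'h comp1m fg.1.1.
- move=> T t; rewrite -compA => /(short_exact_lift fg)[t' ft'].
  by exists t'; rewrite -compA ft' compA hh' comp1m.
Qed.

Lemma simple_iso (X Y : B) : isomorphic X Y -> simple X -> simple Y.
Proof.
move=> iXY [nz sub]; split=> [Y0 | W m mm].
  by apply: nz; apply: is_zero_iso Y0; apply: isomorphic_sym.
have [f [g [gf fg]]] := iXY.
have mg : mono g by apply: is_iso_mono; exists f.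
have [W0 | igm] := sub _ _ (mono_comp mg mm); [by left | right].
apply: iso_mono_epi => //; rewrite -[m]comp1m -fg -compA.
by apply: epi_comp (is_iso_epi igm); apply: is_iso_epi; exists g.
Qed.

Lemma L_e_finite : length_category B -> finitely_many_simples A -> is_finite (L_e E).
Proof.
move=> lenB [n [s sP]]; have [m mP] := fin_all_exists (fun i => lenB (e (s i))).
apply/is_finite_le; exists (\max_i m i)%N; apply/esup_le => _ [S /sP[i iS] ->].
apply/einf_le; exists (m i); split; first exact: leq_bigmax.
exact: composition_series_iso (fmap_iso e (isomorphic_sym iS)) (mP i).
Qed.

(* The simple object [S] of [B] is the image under [e] of the object [i S],
   which is simple since [e] is faithful and exact. *)
Lemma ddell_cat_cleft_ge (OmegaB : syzygy_choice B) (OmegaA : syzygy_choice A) k :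
  preserves_projectives e -> ele (ddell_cat OmegaB k) (ddell_cat OmegaA k).
Proof.
move=> prE; apply: esup_leI => n defn _ [S sS ->].
have /ddell_cat_le dA : ele (ddell_cat OmegaA k) (Fin n) by rewrite defn /=.
apply/ddellP; have exE := @cl_e_exact _ _ E.
have iS : isomorphic (e (cl_i E S)) S.
  exists (iso_to (cl_ei E) S), (iso_from (cl_ei E) S).
  by split; [apply: (iso_fromK (cl_ei E) S) | apply: (iso_toK (cl_ei E) S)].
apply: (ddell_le_iso iS); apply: (ddell_le_functor (c := 0) exE prE).
apply: dA; apply: (faithful_simple exE (@cl_e_faithful _ _ E)).
exact: simple_iso (isomorphic_sym iS) sS.
Qed.

(** Faithfulness keeps [e S] nonzero, which excludes length zero. Positivity of [L] is recorded
    because the predecessor is truncated and is later undone. *)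
Lemma ddell_le_length (OmegaB : syzygy_choice B) k d L S :
  simple S -> ele (composition_length (e S)) (Fin L) ->
  (forall S' : B, simple S' -> ddell_le OmegaB k d S') ->
  (0 < L)%N /\ ddell_le OmegaB k (L * d.+1).-1 (e S).
Proof.
move=> [nzS _] /einf_le[n [le_nL serS]] dB.
have := ddell_le_composition_series serS dB.
case: n le_nL {serS} => [_ eS0 | n lt_nL dS].
  by case: nzS; apply: faithful_zero eS0; [apply: cl_e_exact | apply: cl_e_faithful].
split; first exact: leq_trans lt_nL.
by apply: ddell_leS dS; rewrite -!subn1 leq_sub2r // leq_mul2r lt_nL orbT.
Qed.

Lemma ddell_le_projective_counit (OmegaB : syzygy_choice B) (OmegaA : syzygy_choice A)
    (G : kernel_functor (counit (cl_adj E))) k m (X : A) :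
  exact_functor l -> (forall X : A, projective (G X)) -> (0 < m)%N ->
  ddell_le OmegaB k m (e X) -> ddell_le OmegaA k m X.
Proof.
move=> exl prG m0 mX.
have exG : short_exact (ker_incl G X) (counit (cl_adj E) X).
  apply: kernel_short_exact; first exact: ker_inclP.
  by apply: counit_epi; apply: cl_e_faithful.
apply: ddell_le_projective_kernel m0 (prG X) exG _.
apply: (ddell_le_functor (c := 0) exl _ mX).
by apply: left_adjoint_projective (cl_adj E) _; apply: cl_e_exact.
Qed.

(** * The right adjoint of [e] and the cokernel of its unit *)

Section RightAdjoint.
Variables (r : functor B A) (adj : adjunction e r).
Hypothesis exr : exact_functor r.
Let eta (X : A) : hom X (r (e X)) := unit adj X.
Let eps (Y : B) : hom (e (r Y)) Y := counit adj Y.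

(* With [H X] the cokernel of the unit [X -> r (e X)], adjunction identifies
   [Hom(Y, e (H X))] with the morphisms [e (l Y) -> e X] killed by [u Y], that
   is, with [Hom(F Y, e X)]. *)
Lemma hom_cokernel_unit0 (F : kernel_functor (el_to_id E)) (X W : A)
    (q : hom (r (e X)) W) (Y : B) :
  short_exact (eta X) q -> (forall f : hom (F Y) (e X), f = 0) ->
  forall g : hom Y (e W), g = 0.
Proof.
move=> etaq F0 g; have exe := @cl_e_exact _ _ E; have ex := exe _ _ _ _ _ etaq.
(* By the triangle identity [e] applied to the unit is a split monomorphism with retraction [eps];
   the complementary section [s] of [e q] satisfies [eps ∘ s = 0]. *)
pose d := idm (e (r (e X))) - fmap e (eta X) ∘ eps (e X).
have epsE : eps (e X) ∘ fmap e (eta X) = idm (e X) by apply: triangle_left.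
have [|s sE] := @short_exact_colift _ _ _ _ _ _ ex _ d.
  by rewrite compBl -compA epsE comp1m compm1 subrr.
have eps_s : eps (e X) ∘ s = 0.
  apply: (short_exact_epi ex); rewrite -compA sE comp0m compBr compA epsE.
  by rewrite compm1 comp1m subrr.
have qs : fmap e q ∘ s = idm (e W).
  apply: (short_exact_epi ex); rewrite -compA sE compBr compA (short_exact_comp0 ex).
  by rewrite compm1 comp1m comp0m subr0.
pose h := s ∘ g.
(* The map [f'] is the transpose of [h] under [l] and [e], and [f] below is the transpose of [f']
   under [e] and [r]. Hence [h] vanishes as soon as [f] does. *)
pose f' := counit (cl_adj E) (r (e X)) ∘ fmap l h : hom (l Y) (r (e X)).
have f'u : fmap e f' ∘ u Y = h.
  rewrite fmapM -compA.
  have /= <- := naturality (unit (cl_adj E)) h.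
  by rewrite compA triangle_right comp1m.
pose f := eps (e X) ∘ fmap e f'.
have f'E : fmap r f ∘ eta (l Y) = f'.
  rewrite fmapM -compA.
  have /= <- := naturality (unit adj) f'.
  by rewrite compA triangle_right comp1m.
have fu : f ∘ u Y = 0 by rewrite -compA f'u compA eps_s comp0m.
(* The unit [u Y] splits [el_to_id], so [e (l Y)] is the sum of [Y] and [F Y], and [f] vanishes on
   both. *)
have pu : el_to_id E Y ∘ u Y = idm Y.
  rewrite /= -!compA.
  have /= <- := naturality (unit (cl_adj E)) (iso_from (cl_ei E) Y).
  by rewrite (compA (fmap e _)) triangle_right comp1m; exact: (iso_toK (cl_ei E) Y).
have [|w wE] := @kernel_lift _ _ _ _ _ _ (ker_inclP F Y) _ (idm _ - u Y ∘ el_to_id E Y).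
  by rewrite compBr compA pu compm1 comp1m subrr.
have f0 : f = 0.
  rewrite -[f]compm1 -[idm _](subrK (u Y ∘ el_to_id E Y)) compDr -wE !compA fu.
  by rewrite (F0 (f ∘ _)) !comp0m addr0.
have h0 : h = 0.
  by rewrite -f'u -f'E f0 exact_functor0 // comp0m exact_functor0 // comp0m.
by rewrite -[g]comp1m -qs -compA -/h h0 compm0.
Qed.

Variables (OmegaB : syzygy_choice B) (OmegaA : syzygy_choice A) (c : nat).
Hypothesis pd_r : ele (pd_functor r) (Fin c).

Lemma ddell_le_right_adjoint k m (Y : B) :
  ddell_le OmegaB k m Y -> ddell_le OmegaA k (c + m) (r Y).
Proof.
apply: ddell_le_functor => // P prP; apply: pd_iter_syzygy.
by move/esup_le: pd_r; apply; exists P.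
Qed.

Lemma ddell_le_unit k m n (X W : A) (q : hom (r (e X)) W) :
  short_exact (eta X) q -> ddell_le OmegaB k m (e X) ->
  ddell_le OmegaA k n (OmegaA W) -> ddell_le OmegaA k (n + (c + m)).+1 X.
Proof. by move=> etaq mX nW; apply: ddell_le_sub etaq nW (ddell_le_right_adjoint mX). Qed.

Lemma has_unit_cokernel X : exists W (q : hom (r (e X)) W), short_exact (eta X) q.
Proof. by apply: mono_short_exact; apply: unit_mono; apply: cl_e_faithful. Qed.

(** The condition on [X] is a vanishing of morphisms because this form passes to the cokernel [W] of
    the unit with [n] lowered by one. At [n = 0] it kills the identity of [e X], and faithfulness
    gives [X = 0]. *)
Lemma ddell_le_nilpotent (F : kernel_functor (el_to_id E)) n k :
  (forall Y, exists m, ddell_le OmegaB k m Y) ->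
  forall X, (forall Y (f : hom (iter n F Y) (e X)), f = 0) -> exists m, ddell_le OmegaA k m X.
Proof.
move=> finB; elim: n => [|n IHn] X F0.
  exists 0%N; apply/DdellLeDell/dell_le_projective/projective_zero.
  apply: (faithful_zero (@cl_e_exact _ _ E) (@cl_e_faithful _ _ E)).
  exact/is_zeroP/(F0 (e X)).
have [W [q etaq]] := has_unit_cokernel X.
have [|n' nW] := IHn W.
  by move=> Y; apply: hom_cokernel_unit0 etaq _ => f; apply: F0.
have [m mX] := finB (e X); exists (n' + (c + m)).+1.
exact/(ddell_le_unit etaq mX)/ddell_le_pred/ddell_le_syzygy.
Qed.

End RightAdjoint.

End Cleft.

(** * Combination of the lower and upper bounds *)

Theorem theorem1p1 (B A : abelian)
    (lengthB : length_category B) (lengthA : length_category A)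
    (simplesB : finitely_many_simples B) (simplesA : finitely_many_simples A)
    (projB : enough_projectives B) (projA : enough_projectives A)
    (OmegaB : syzygy_choice B) (OmegaA : syzygy_choice A)
    (E : cleft_extension B A)
    (G : kernel_functor (counit (cl_adj E)))
    (F : kernel_functor (el_to_id E))
    (l_exact : exact_functor (cl_l E))
    (e_proj : preserves_projectives (cl_e E)) :
  (* (a) *)
  (forall (r : functor B A) (adj_er : adjunction (cl_e E) r),
     exact_functor r -> is_finite (pd_functor r) ->
     (ele (ddell_cat OmegaB 1) (ddell_cat OmegaA 1) /\
      ele (ddell_cat OmegaA 1)
          (eadd (pd_functor r)
                (emul (L_e E) (eadd (ddell_cat OmegaB 1) (Fin 1))))) /\
     (forall n : nat, (1 <= n)%N ->
        (forall X : B, is_zero (iter n F X)) -> is_finite (pd_functor r) ->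
        forall k : nat, (1 <= k)%N ->
          is_finite (ddell_cat OmegaA k) <-> is_finite (ddell_cat OmegaB k)))
  /\
  (* (b) *)
  ((forall X : A, projective (G X)) ->
     forall k : nat, (1 <= k)%N ->
       [/\ ele (ddell_cat OmegaB k) (ddell_cat OmegaA k),
           ele (ddell_cat OmegaA k)
               (emax (Fin 1)
                     (epred (emul (L_e E)
                                  (eadd (ddell_cat OmegaB k) (Fin 1)))))
         & is_finite (ddell_cat OmegaA k) <-> is_finite (ddell_cat OmegaB k)]).
Proof.
have lower k := ddell_cat_cleft_ge OmegaB OmegaA k e_proj.
have fin_of_le k n : ele (ddell_cat OmegaA k) (Fin n) -> is_finite (ddell_cat OmegaB k).
  by move=> An; apply/is_finite_le; exists n; apply: ele_trans (lower k) An.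
have finB k : is_finite (ddell_cat OmegaB k) -> forall Y, exists m, ddell_le OmegaB k m Y.
  case/is_finite_le=> d /ddell_cat_le; exact: ddell_le_length_category.
have length_e L : L_e E = Fin L -> forall S : A, simple S ->
    ele (composition_length (cl_e E S)) (Fin L).
  move=> defL S sS; have : ele (L_e E) (Fin L) by rewrite defL /=.
  by rewrite /L_e esup_le; apply; exists S.
split=> [r adj exr [c def_c] | prG k k1].
  have pd_r : ele (pd_functor r) (Fin c) by rewrite def_c /=.
  split; [split; first exact: lower | move=> n _ Fn _ k _].
    rewrite def_c; apply: esup_leI => n defn _ [S sS ->].
    (* If [L_e] or the level of [B] is [Inf], the right-hand side is [Inf], contrary to its being
       [Fin n]. *)
    case defL: (L_e E) defn => [L|] //; case defd: (ddell_cat OmegaB 1) => [d|] //= [<-].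
    have /ddell_cat_le dB : ele (ddell_cat OmegaB 1) (Fin d) by rewrite defd /=.
    have [L0 dS] := ddell_le_length sS (length_e L defL S sS) dB.
    have [W [q etaq]] := has_unit_cokernel adj S.
    (* Here [k = 1] is essential: a first syzygy has 1-dell zero. The resulting bound
       [0 + (c + (L (d + 1) - 1)) + 1] equals [c + L (d + 1)] since [L] is positive. *)
    have dW : ddell_le OmegaA 1 0 (OmegaA W) by apply/DdellLeDell/(@dell_le_iter_syzygy _ _ 1).
    apply/ddellP; apply: ddell_leS (ddell_le_unit exr pd_r etaq dS dW).
    by rewrite add0n addn1 -addnS prednK // muln_gt0 L0.
  split=> [[m defm] | /finB finYB]; first by apply: (fin_of_le k m); rewrite defm /=.
  apply: ddell_cat_finite => // X.
  apply: (ddell_le_nilpotent adj exr OmegaA pd_r finYB) => Y f; exact: ((Fn Y _).1).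
have upper : ele (ddell_cat OmegaA k)
    (emax (Fin 1) (epred (emul (L_e E) (eadd (ddell_cat OmegaB k) (Fin 1))))).
  apply: esup_leI => n defn _ [S sS ->].
  case defL: (L_e E) defn => [L|] //; case defd: (ddell_cat OmegaB k) => [d|] //= [<-].
  have /ddell_cat_le dB : ele (ddell_cat OmegaB k) (Fin d) by rewrite defd /=.
  have [L0 dS] := ddell_le_length sS (length_e L defL S sS) dB.
  (* The maximum with [1] provides the positive level needed to pass to a quotient by a projective
     kernel. *)
  apply/ddellP; apply: (ddell_le_projective_counit (OmegaB := OmegaB) OmegaA l_exact prG).
    by rewrite leq_max.
  by apply: ddell_leS dS; rewrite addn1 leq_maxr.
split=> //; split=> [[m defm] | [d defd]]; first by apply: (fin_of_le k m); rewrite defm /=.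
have [L defL] := L_e_finite E lengthB simplesA.
by apply/is_finite_le; move: upper; rewrite defd defL /=; eexists; eassumption.
Qed.
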